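(* Let $q$ be a complex number with $|q|<1$. Then $$H\left(\frac{(q^4,q^2,q^{-1};q^3)_\infty}{(q^9;q^9)_\infty}\sum_{n\ge 0} \frac{(-1)^n q^{3\binom{n}{2}+4n}(q;q^3)_n}{(q^9;q^9)_n}\right) = \frac{1}{(q^3;q^3)_\infty (q^6,q^9;q^{18})_\infty}.$$
   Context: For $n\in\mathbb{N}\cup\{\infty\}$, $(A;q)_n:=\prod_{k=0}^{n-1}(1-Aq^k)$ and $(A_1,\ldots,A_m;q)_n:=(A_1;q)_n\cdots(A_m;q)_n$. The huffing operator $H$ acts on a (Laurent) series in $q$ by $H\left(\sum_n a(n)q^n\right):=\sum_n a(3n)q^{3n}$, i.e. it keeps exactly the terms whose exponent of $q$ is divisible by $3$ (the expression inside $H$ is expanded as a Laurent series in $q$). *)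

(* Defs.v *)
From HB Require Import structures.
From mathcomp Require Import all_boot all_order all_algebra.
From mathcomp Require Import all_classical all_reals all_analysis.
From mathcomp.real_closed Require Import complex.

Set Implicit Arguments.
Unset Strict Implicit.
Unset Printing Implicit Defensive.

Import Order.TTheory GRing.Theory Num.Theory.
Import numFieldNormedType.Exports.
Local Open Scope classical_set_scope.
Local Open Scope ring_scope.

Definition qpoch (C : numFieldType) (A q : C) (n : nat) : C :=
  \prod_(k < n) (1 - A * q ^+ k).

Definition qpoch_inf (C : numFieldType) (A q : C) : C :=
  limn (qpoch A q).

(* (A_1, ..., A_m; q)_oo *)
Definition qpochs_inf (C : numFieldType) (s : seq C) (q : C) : C :=
  \prod_(A <- s) qpoch_inf A q.

Definition series_sum (C : numFieldType) (u : nat -> C) : C :=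
  limn (series u).

(* A Laurent series is given by its coefficients a : int -> C, which must vanish
   below some exponent -N; the choice of N does not affect the sum. When q = 0,
   negative powers of q evaluate to 0, so only the constant term survives. *)
Definition laurent_sum (C : numFieldType) (a : int -> C) (q s : C) : Prop :=
  exists N : nat,
    (forall n : int, n < - N%:Z -> a n = 0) /\
    series (fun k : nat => a (k%:Z - N%:Z) * q ^ (k%:Z - N%:Z)) @ \oo --> s.

(* a is the Laurent expansion at 0 of f in the punctured unit disc. *)
Definition laurent_expansion (C : numFieldType) (f : C -> C) (a : int -> C)
    : Prop :=
  forall q : C, 0 < `|q| < 1 -> laurent_sum a q (f q).

Definition huff (C : numFieldType) (a : int -> C) : int -> C :=
  fun n => if (3 %| n)%Z then a n else 0.

(* Main.v *)
Require Import Defs.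
From mathcomp Require Import all_boot all_order all_algebra.
From mathcomp Require Import all_classical all_reals all_analysis.
From mathcomp.real_closed Require Import complex.
From mathcomp Require Import ring lra zify.
Import Order.TTheory GRing.Theory Num.Theory.
Import numFieldNormedType.Exports.
Local Open Scope classical_set_scope.
Local Open Scope ring_scope.

Set Implicit Arguments.
Unset Strict Implicit.
Unset Printing Implicit Defensive.

(** Write Q = q^3 and f_k = (q^k; q^k)_oo. The sum over n is the case a = q of
      X(a) = sum_n (-1)^n Q^(n(n-1)/2) (aQ)^n (a; Q)_n (Q^2/a; Q^2)_n
                   / ((Q^3; Q^3)_n (a^2 Q; Q^2)_n),
    since a^3 = Q makes (Q^2/a; Q^2)_n and (a^2 Q; Q^2)_n cancel. A WZ certificate
    gives X(a Q^2) = rho(a) X(a) with rho rational, and X(a) tends to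
    (-Q^3; Q^3)_oo as a tends to 0 by Euler's expansion, so
      X(a) = (-Q^3; Q^3)_oo (aQ; Q^2)_oo (a^3 Q^3; Q^6)_oo / (a^2 Q; Q^2)_oo.
    At a = q the function inside H therefore equals -q^(-1) f_1 f_2 E(q^3) for an
    infinite product E. By Gauss, f_1 f_2 = phi(-q) psi(q); splitting both theta
    series modulo 3 and using the Jacobi triple product, the part of f_1 f_2 with
    exponents congruent to 1 modulo 3 is -q f_9 f_18. Hence H yields
    f_9 f_18 E(q^3), which is the right-hand side; H itself is computed by
    averaging over q, wq, w^2 q with w a primitive cube root of unity. *)

(** * Limits and series of complex numbers *)

Section ComplexSequences.
Variable R : realType.
Local Notation C := (R[i] : numFieldType).
Implicit Types (x y z : C) (u v : nat -> C).

(** With a tied to q there is no variable left to shift. Once a is free and Q is fixed, the sum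
    obeys a first-order recurrence along a, a Q^2, a Q^4, ..., whose limit 0 is a point where the
    sum is already known. H acts on coefficients, whereas the product formulas are about values at q
    != 0. Averaging over the cube roots of unity needs only values: whatever depends on q^3 alone is
    unchanged, so the three residue classes separate. At q = 0 the factor q^-1 rules out this
    argument. That point is reached by uniqueness of coefficients: the right-hand side is a power
    series on the whole disc, and a Laurent series with the same sums off 0 must have the same
    coefficients. For this, and for the existence of an expansion, infinite products have to be
    expanded as power series. *)

Definition cnorm x : R := complex.Re `|x|.

(** The norm on [R[i]] takes values in [R[i]]; bounds are moved to [R], where [expR] and [lra]
    apply. *)
Lemma cnormE x : `|x| = (cnorm x)%:C%C.
Proof. by rewrite /cnorm normc_def. Qed.

Lemma cnorm_ge0 x : 0 <= cnorm x.
Proof. by rewrite -lecR -cnormE normr_ge0. Qed.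

Lemma cnorm0 : cnorm 0 = 0.
Proof. by rewrite /cnorm normr0. Qed.

Lemma cnorm1 : cnorm 1 = 1.
Proof. by rewrite /cnorm normr1. Qed.

Lemma cnormM x y : cnorm (x * y) = cnorm x * cnorm y.
Proof. by apply: (@complexI R); rewrite rmorphM /= -!cnormE normrM. Qed.

Lemma cnormN x : cnorm (- x) = cnorm x.
Proof. by rewrite /cnorm normrN. Qed.

Lemma cnormX x n : cnorm (x ^+ n) = cnorm x ^+ n.
Proof. by elim: n => [|n IH]; rewrite ?expr0 ?cnorm1 // !exprS cnormM IH. Qed.

Lemma cnormV x : cnorm x^-1 = (cnorm x)^-1.
Proof. by apply: (@complexI R); rewrite fmorphV /= -!cnormE normfV. Qed.

Lemma cnormD x y : cnorm (x + y) <= cnorm x + cnorm y.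
Proof. by rewrite -lecR rmorphD /= -!cnormE ler_normD. Qed.

Lemma cnormB x y : cnorm (x - y) <= cnorm x + cnorm y.
Proof. by rewrite -(cnormN y) cnormD. Qed.

Lemma cnormDC x y : cnorm (x - y) = cnorm (y - x).
Proof. by rewrite -cnormN opprB. Qed.

Lemma cnorm_eq0 x : (cnorm x == 0) = (x == 0).
Proof. by rewrite -(inj_eq (@complexI R)) -cnormE normr_eq0. Qed.

Lemma cnorm_gt0 x : (0 < cnorm x) = (x != 0).
Proof. by rewrite lt_def cnorm_ge0 andbT cnorm_eq0. Qed.

Lemma cnorm_lt1 x : (cnorm x < 1) = (`|x| < 1).
Proof. by rewrite cnormE -[1 in RHS](rmorph1 (real_complex R)) ltcR. Qed.

Lemma cnormRe x : `|complex.Re x| <= cnorm x.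
Proof. by rewrite -lecR -cnormE normc_ge_Re. Qed.

Lemma cnormr (a : R) : cnorm a%:C%C = `|a|.
Proof. by rewrite /cnorm normc_def /= expr0n addr0 sqrtr_sqr. Qed.

Lemma cnorm_sum (I : Type) (r : seq I) (P : pred I) (F : I -> C) :
  cnorm (\sum_(i <- r | P i) F i) <= \sum_(i <- r | P i) cnorm (F i).
Proof.
elim/big_ind2: _ => [|a x b y ha hb|//]; first by rewrite cnorm0.
by apply: le_trans (cnormD _ _) _; rewrite lerD.
Qed.

Lemma cnorm_prod (I : Type) (r : seq I) (P : pred I) (F : I -> C) :
  cnorm (\prod_(i <- r | P i) F i) = \prod_(i <- r | P i) cnorm (F i).
Proof. by apply: (big_morph cnorm cnormM cnorm1). Qed.

Lemma cvg_cnormP u x :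
  u @ \oo --> x <-> (forall e : R, 0 < e -> \forall n \near \oo, cnorm (u n - x) < e).
Proof.
split=> [/cvgrPdist_lt h e e0|h].
  have := h e%:C%C; rewrite ltcR => /(_ e0).
  by apply: filterS => n; rewrite cnormE ltcR cnormDC.
apply/cvgrPdist_lt => e e0.
have ee : e = (complex.Re e)%:C%C.
  by apply/esym/eqP; rewrite RRe_real // ger0_real // ltW.
have := h (complex.Re e); rewrite -ltcR -ee => /(_ e0).
by apply: filterS => n; rewrite -ltcR -ee -cnormE distrC.
Qed.

Lemma cvg_cnorm_le u x (v : nat -> R) :
  (\forall n \near \oo, cnorm (u n - x) <= v n) -> v @ \oo --> 0 -> u @ \oo --> x.
Proof.
move=> uv v0; apply/cvg_cnormP => e e0.
have /cvgrPdist_lt /(_ e e0) := v0.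
apply: filterS2 uv => n h; rewrite sub0r normrN; apply: le_lt_trans.
exact: le_trans h (ler_norm _).
Qed.

Lemma limnE u x : u @ \oo --> x -> limn u = x.
Proof. by apply: cvg_lim; exact: norm_hausdorff. Qed.

Lemma cvg_uniq u x y : u @ \oo --> x -> u @ \oo --> y -> x = y.
Proof. by move=> /limnE <- /limnE <-. Qed.

(** The slack [d] admits indices such as [n - k], for which [n <= f n] fails. *)
Lemma cvg_comp_natD u (f : nat -> nat) d x :
  (forall n, (n <= f n + d)%N) -> u @ \oo --> x -> (fun n => u (f n)) @ \oo --> x.
Proof.
move=> fn /cvg_cnormP h; apply/cvg_cnormP => e /h [N _ hN].
exists (N + d)%N => // n /= Nn; apply: hN => /=.
by rewrite -(leq_add2r d); apply: leq_trans (fn n).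
Qed.

Lemma cvg_comp_nat u (f : nat -> nat) x :
  (forall n, (n <= f n)%N) -> u @ \oo --> x -> (fun n => u (f n)) @ \oo --> x.
Proof. by move=> fn; apply: (@cvg_comp_natD _ _ 0) => n; rewrite addn0. Qed.

Lemma series_fin_cvg u n :
  (forall k, (n <= k)%N -> u k = 0) -> series u @ \oo --> \sum_(k < n) u k.
Proof.
move=> h; apply: (@cvg_cnorm_le _ _ (fun=> 0)); last exact: cvg_cst.
exists n => // m /= nm; rewrite /series /= (big_cat_nat _ nm) //= big_mkord.
rewrite [X in _ + X - _]big_nat_cond [X in _ + X - _]big1 ?addr0 ?subrr ?cnorm0 //.
by move=> k /andP[/andP[nk _] _]; apply: h.
Qed.

Lemma geo_cvg0 (M r : R) : 0 <= r < 1 -> (fun n => M * r ^+ n) @ \oo --> 0.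
Proof.
move=> /andP[r0 r1]; rewrite -(mulr0 M); apply: cvgM; first exact: cvg_cst.
by apply: cvg_expr; rewrite ger0_norm.
Qed.

Lemma geo_sum_le (M r : R) m n : 0 <= r < 1 -> 0 <= M ->
  \sum_(m <= k < n) M * r ^+ k <= M * r ^+ m / (1 - r).
Proof.
move=> /andP[r0 r1] M0; have r1' : 0 < 1 - r by rewrite subr_gt0.
rewrite -big_distrr /= -mulrA ler_wpM2l // ler_pdivlMr //.
have [mn|nm] := leqP m n; last first.
  by rewrite big_geq ?mul0r ?exprn_ge0 // ltnW.
have -> : (\sum_(m <= k < n) r ^+ k) * (1 - r) = r ^+ m - r ^+ n.
  rewrite big_distrl /= (eq_bigr (fun k => r ^+ k - r ^+ k.+1)); last first.
    by move=> k _; rewrite exprS; ring.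
  by rewrite (@telescope_sumr_eq _ _ _ (fun k => - r ^+ k)) // => [|k _]; ring.
by rewrite lerBlDr lerDl exprn_ge0.
Qed.

(** Completeness is used in [R] only: the real and imaginary parts are dominated separately. *)
Lemma geo_series_cvg u (M r : R) : 0 <= r < 1 ->
  (forall n, cnorm (u n) <= M * r ^+ n) -> exists s : C, series u @ \oo --> s.
Proof.
move=> r01 hu; have /andP[r0 r1] := r01.
have real_cvg (f : nat -> R) : (forall n, `|f n| <= M * r ^+ n) -> cvgn (series f).
  move=> hf; apply: normed_cvg.
  apply: (@series_le_cvg _ (fun n => `|f n|) (geometric M r)) => //.
  - by move=> n; apply: le_trans (hf n).
  - by apply: is_cvg_geometric_series; rewrite ger0_norm.
have hRe := real_cvg (fun n => complex.Re (u n)) (fun n => le_trans (cnormRe _) (hu n)).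
have hIm := real_cvg (fun n => complex.Im (u n)).
have {}hIm : cvgn (series (fun n => complex.Im (u n))).
  apply: hIm => n; have := hu n; apply: le_trans.
  have -> : complex.Im (u n) = complex.Re (- 'i%C * u n).
    by case: (u n) => a b /=; ring.
  apply: le_trans (cnormRe _) _; rewrite cnormM cnormN.
  by rewrite /cnorm normc_def /= expr0n expr1n add0r sqrtr1 mul1r.
set a := limn _ in hRe; set b := limn _ in hIm.
exists (a%:C + 'i * b%:C)%C.
apply/cvg_cnormP => e e0; have e2 : 0 < e / 2 by rewrite divr_gt0.
have /cvgrPdist_lt /(_ _ e2) := hRe; have /cvgrPdist_lt /(_ _ e2) := hIm.
apply: filterS2 => n hb ha.
have -> : series u n = ((series (fun n => complex.Re (u n)) n)%:C +
   'i * (series (fun n => complex.Im (u n)) n)%:C)%C.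
  rewrite /series /= !rmorph_sum /= big_distrr -big_split /=.
  by apply: eq_bigr => k _; rewrite -complexE.
set a' := series _ n in ha *; set b' := series _ n in hb *.
have -> : (a'%:C + 'i * b'%:C - (a%:C + 'i * b%:C))%C = (a' - a)%:C%C + 'i%C * (b' - b)%:C%C.
  by rewrite !rmorphB /= mulrBr opprD addrACA.
apply: le_lt_trans (cnormD _ _) _; rewrite cnormM !cnormr.
have -> : cnorm 'i%C = 1 by rewrite /cnorm normc_def /= expr0n expr1n add0r sqrtr1.
by rewrite mul1r (splitr e) ltrD // distrC.
Qed.

Lemma cnorm_lim_le u x (M : R) :
  (\forall n \near \oo, cnorm (u n) <= M) -> u @ \oo --> x -> cnorm x <= M.
Proof.
move=> hM /cvg_cnormP h; apply/ler_addgt0Pr => e e0.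
have [n [h1 h2]] := filter_ex (filterI hM (h e e0)).
have -> : x = u n - (u n - x) by ring.
by apply: le_trans (cnormB _ _) _; rewrite lerD // ltW.
Qed.

Lemma geo_series_tail u (M r : R) x m : 0 <= r < 1 -> 0 <= M ->
  (forall n, cnorm (u n) <= M * r ^+ n) -> series u @ \oo --> x ->
  cnorm (x - series u m) <= M * r ^+ m / (1 - r).
Proof.
move=> r01 M0 hu hx; apply: (@cnorm_lim_le (fun n => series u n - series u m)).
  exists m => // n /= mn; rewrite sub_series_geq //.
  apply: le_trans (cnorm_sum _ _ _) _; apply: le_trans (geo_sum_le _ _ r01 M0).
  by apply: ler_sum.
exact: cvgB hx (cvg_cst _).
Qed.

(** Tannery's theorem: cut where both geometric tails are below e/3, then use termwise limits on the
    finite part. Each interchange of limit and sum below rests on it: Euler, Jacobi, a tending to 0,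
    Cauchy products, infinite products. *)
Lemma tannery (f : nat -> nat -> C) (v s : nat -> C) x (M r : R) :
  0 <= r < 1 -> 0 <= M ->
  (forall n k, cnorm (f n k) <= M * r ^+ k) ->
  (forall k, (fun n => f n k) @ \oo --> v k) ->
  (forall n, series (f n) @ \oo --> s n) -> series v @ \oo --> x ->
  s @ \oo --> x.
Proof.
move=> r01 M0 hf fv fs vx.
have hv k : cnorm (v k) <= M * r ^+ k.
  by apply: cnorm_lim_le (fv k); apply: nearW.
apply/cvg_cnormP => e e0; have e3 : 0 < e / 3 by rewrite divr_gt0.
have tail0 : (fun m => M * r ^+ m / (1 - r)) @ \oo --> 0.
  under eq_fun do rewrite mulrAC.
  exact: geo_cvg0.
have /cvgrPdist_lt /(_ _ e3) := tail0; case=> m _ /(_ m (leqnn m)).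
rewrite sub0r normrN => hm.
have {}hm : M * r ^+ m / (1 - r) < e / 3 by apply: le_lt_trans (ler_norm _) hm.
have : (fun n => series (f n) m) @ \oo --> series v m.
  elim: {hm} m => [|m IH].
    have series0 u : series u 0 = 0 by rewrite seriesEnat /= big_geq.
    rewrite series0; under eq_fun do rewrite series0.
    exact: cvg_cst.
  rewrite seriesSr; under eq_fun do rewrite seriesSr.
  exact: cvgD IH (fv m).
move=> /cvg_cnormP /(_ _ e3); apply: filterS => n hn.
have -> : s n - x = (s n - series (f n) m) + (series (f n) m - series v m)
                    - (x - series v m) by ring.
apply: le_lt_trans (cnormB _ _) _.
have h1 := le_lt_trans (geo_series_tail m r01 M0 (hf n) (fs n)) hm.
have h2 := le_lt_trans (geo_series_tail m r01 M0 hv vx) hm.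
have h3 := cnormD (s n - series (f n) m) (series (f n) m - series v m).
lra.
Qed.

End ComplexSequences.

(** * The q-Pochhammer symbol *)

Section QPochhammer.
Variable C : numFieldType.
Implicit Types (A q : C) (n : nat).

Lemma qpoch0 A q : qpoch A q 0 = 1.
Proof. by rewrite /qpoch big_ord0. Qed.

Lemma qpochS A q n : qpoch A q n.+1 = qpoch A q n * (1 - A * q ^+ n).
Proof. by rewrite /qpoch big_ord_recr. Qed.

Lemma qpochSl A q n : qpoch A q n.+1 = (1 - A) * qpoch (A * q) q n.
Proof.
rewrite /qpoch big_ord_recl expr0 mulr1; congr (_ * _).
by apply: eq_bigr => k _; rewrite -mulrA -exprS.
Qed.

Lemma qpoch_double A q n :
  qpoch A q n.*2 = qpoch A (q ^+ 2) n * qpoch (A * q) (q ^+ 2) n.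
Proof.
elim: n => [|n IH]; first by rewrite !qpoch0 mulr1.
rewrite doubleS !qpochS IH -!exprM mul2n [q ^+ n.*2.+1]exprS; ring.
Qed.

Lemma qpoch_triple A q n : qpoch A q (3 * n) =
  qpoch A (q ^+ 3) n * qpoch (A * q) (q ^+ 3) n * qpoch (A * q ^+ 2) (q ^+ 3) n.
Proof.
elim: n => [|n IH]; first by rewrite muln0 !qpoch0 !mulr1.
rewrite mulnS !addSn add0n !qpochS IH -!exprM [q ^+ (3 * n).+2]exprS.
rewrite [q ^+ (3 * n).+1]exprS; ring.
Qed.

Lemma qpoch_opp A q n : qpoch (A ^+ 2) (q ^+ 2) n = qpoch A q n * qpoch (- A) q n.
Proof.
elim: n => [|n IH]; first by rewrite !qpoch0 mulr1.
by rewrite !qpochS IH -exprM mulnC exprM; ring.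
Qed.

End QPochhammer.

(** * Bounds and convergence of q-Pochhammer symbols, and identities between infinite ones *)

Section QPochhammerLimit.
Variable R : realType.
Local Notation C := (R[i] : numFieldType).
Implicit Types (A q : C) (n : nat).

Lemma cnorm_prod_le (F : nat -> C) (c r : R) n : 0 <= c -> 0 <= r < 1 ->
  (forall k, cnorm (F k) <= 1 + c * r ^+ k) ->
  cnorm (\prod_(k < n) F k) <= expR (c / (1 - r)).
Proof.
move=> c0 r01 hF; have := geo_sum_le 0 n r01 c0; rewrite expr0 mulr1 => hS.
apply: le_trans (_ : expR (\sum_(0 <= k < n) c * r ^+ k) <= _); last first.
  by rewrite ler_expR.
rewrite expR_sum cnorm_prod big_mkord; apply: ler_prod => k _.
by rewrite cnorm_ge0 /=; apply: le_trans (hF k) _; rewrite expR_ge1Dx.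
Qed.

Lemma qpoch_le A q n : cnorm q < 1 ->
  cnorm (qpoch A q n) <= expR (cnorm A / (1 - cnorm q)).
Proof.
move=> q1; apply: (@cnorm_prod_le (fun k => 1 - A * q ^+ k)); rewrite ?cnorm_ge0 // => k.
by apply: le_trans (cnormB _ _) _; rewrite cnorm1 cnormM cnormX.
Qed.

(** For 0 <= x <= rho, 1/(1 - x) <= 1 + x/(1 - rho) <= exp(x/(1 - rho)). The bound is uniform in A,
    q and n, as domination arguments require. *)
Lemma qpoch_ge (rho r : R) : 0 <= rho < 1 -> 0 <= r < 1 ->
  exists2 m : R, 0 < m & forall A q n, cnorm A <= rho -> cnorm q <= r ->
    m <= cnorm (qpoch A q n).
Proof.
move=> /andP[p0 p1] r01; have /andP[r0 r1] := r01.
exists (expR (- (rho / (1 - r) / (1 - rho)))); first exact: expR_gt0.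
move=> A q n Ap qr.
apply: le_trans (_ : expR (\sum_(0 <= k < n) (- (rho * r ^+ k / (1 - rho)))) <= _).
  rewrite ler_expR sumrN lerN2 -big_distrl /= ler_wpM2r ?invr_ge0 ?subr_ge0 ?(ltW p1) //.
  by have := geo_sum_le 0 n r01 p0; rewrite expr0 mulr1.
rewrite expR_sum /qpoch cnorm_prod big_mkord; apply: ler_prod => k _.
rewrite expR_ge0 /=.
have hx : cnorm (A * q ^+ k) <= rho * r ^+ k.
  rewrite cnormM cnormX ler_pM ?cnorm_ge0 ?exprn_ge0 ?cnorm_ge0 //.
  by rewrite lerXn2r ?nnegrE ?cnorm_ge0.
set x := rho * r ^+ k in hx *.
have x0 : 0 <= x by rewrite mulr_ge0 ?exprn_ge0.
have xp : x <= rho by rewrite -[leRHS]mulr1 ler_wpM2l // exprn_ile1 // ltW.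
have rp : 0 < 1 - rho by rewrite subr_gt0.
have x1 : 0 < 1 - x by rewrite subr_gt0; apply: le_lt_trans xp p1.
apply: le_trans (_ : 1 - x <= _); last first.
  have := cnormD (1 - A * q ^+ k) (A * q ^+ k); rewrite subrK cnorm1.
  by move=> h; rewrite lerBlDr; apply: le_trans h _; rewrite lerD2l.
rewrite expRN -[leRHS]invrK lef_pV2 ?posrE ?expR_gt0 ?invr_gt0 //.
apply: le_trans (_ : 1 + x / (1 - rho) <= _); last exact: expR_ge1Dx.
have -> : (1 - x)^-1 = 1 + x / (1 - x) by field; rewrite gt_eqF.
by rewrite lerD2l ler_wpM2l // lef_pV2 ?posrE // lerD2l lerN2.
Qed.

Lemma qpoch_neq0 A q n : cnorm A < 1 -> cnorm q < 1 -> qpoch A q n != 0.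
Proof.
move=> A1 q1; have [||m m0 h] := @qpoch_ge (cnorm A) (cnorm q); rewrite ?cnorm_ge0 //.
by rewrite -cnorm_gt0; apply: lt_le_trans m0 _; apply: h.
Qed.

Lemma qpoch_cvg A q : cnorm q < 1 -> qpoch A q @ \oo --> qpoch_inf A q.
Proof.
move=> q1; have q01 : 0 <= cnorm q < 1 by rewrite cnorm_ge0.
(* The increments of [qpoch A q] decay geometrically, so the sequence is 1 plus a convergent
   series. *)
have [n|s hs] := @geo_series_cvg _ (fun n => - (qpoch A q n * (A * q ^+ n)))
    (expR (cnorm A / (1 - cnorm q)) * cnorm A) (cnorm q) q01.
  rewrite cnormN !cnormM cnormX mulrA ler_wpM2r ?exprn_ge0 ?cnorm_ge0 //.
  by rewrite ler_wpM2r ?cnorm_ge0 // qpoch_le.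
have h : qpoch A q @ \oo --> 1 + s.
  have -> : qpoch A q = (fun n => 1 + series (fun n => - (qpoch A q n * (A * q ^+ n))) n).
    apply/funext; elim=> [|n IH]; first by rewrite /series /= big_geq // addr0 qpoch0.
    by rewrite qpochS {1}IH seriesSr addrA -IH; ring.
  exact: cvgD (cvg_cst _) hs.
by rewrite /qpoch_inf (limnE h).
Qed.

Lemma qpoch_inf_neq0 A q : cnorm A < 1 -> cnorm q < 1 -> qpoch_inf A q != 0.
Proof.
move=> A1 q1; have [||m m0 h] := @qpoch_ge (cnorm A) (cnorm q); rewrite ?cnorm_ge0 //.
apply/negP => /eqP z; have := qpoch_cvg (A := A) q1; rewrite z => /cvg_cnormP /(_ m m0).
by case=> n _ /(_ n (leqnn n)); rewrite subr0 ltNge h.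
Qed.

Lemma cnormX_lt1 q k : cnorm q < 1 -> (0 < k)%N -> cnorm (q ^+ k) < 1.
Proof. by move=> q1 k0; rewrite cnormX exprn_ilt1 ?cnorm_ge0 // -lt0n. Qed.

Lemma qpoch_infS A q : cnorm q < 1 -> qpoch_inf A q = (1 - A) * qpoch_inf (A * q) q.
Proof.
move=> q1; apply: (cvg_uniq (u := fun n => qpoch A q n.+1)).
  exact: cvg_comp_nat (qpoch_cvg q1).
under eq_fun do rewrite qpochSl.
exact: cvgM (cvg_cst _) (qpoch_cvg q1).
Qed.

Lemma qpoch_inf_double A q : cnorm q < 1 ->
  qpoch_inf A q = qpoch_inf A (q ^+ 2) * qpoch_inf (A * q) (q ^+ 2).
Proof.
move=> q1; have q2 := cnormX_lt1 q1 (isT : 0 < 2)%N.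
apply: (cvg_uniq (u := fun n => qpoch A q n.*2)).
  by apply: cvg_comp_nat (qpoch_cvg q1) => n; rewrite -addnn leq_addr.
under eq_fun do rewrite qpoch_double.
exact: cvgM (qpoch_cvg q2) (qpoch_cvg q2).
Qed.

Lemma qpoch_inf_triple A q : cnorm q < 1 -> qpoch_inf A q =
  qpoch_inf A (q ^+ 3) * qpoch_inf (A * q) (q ^+ 3) * qpoch_inf (A * q ^+ 2) (q ^+ 3).
Proof.
move=> q1; have q2 := cnormX_lt1 q1 (isT : 0 < 3)%N.
apply: (cvg_uniq (u := fun n => qpoch A q (3 * n))).
  by apply: cvg_comp_nat (qpoch_cvg q1) => n; rewrite leq_pmull.
under eq_fun do rewrite qpoch_triple.
exact: cvgM (cvgM (qpoch_cvg q2) (qpoch_cvg q2)) (qpoch_cvg q2).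
Qed.

Lemma qpoch_inf_opp A q : cnorm q < 1 ->
  qpoch_inf (A ^+ 2) (q ^+ 2) = qpoch_inf A q * qpoch_inf (- A) q.
Proof.
move=> q1; have q2 := cnormX_lt1 q1 (isT : 0 < 2)%N.
apply: (cvg_uniq (u := qpoch (A ^+ 2) (q ^+ 2))); first exact: qpoch_cvg.
rewrite (funext (qpoch_opp A q)).
exact: cvgM (qpoch_cvg q1) (qpoch_cvg q1).
Qed.

(** Euler's identity on partitions into distinct and odd parts: multiply by (q; q)_oo and use (q;
    q)_oo (-q; q)_oo = (q^2; q^2)_oo. *)
Lemma qpoch_inf_odd_distinct q : cnorm q < 1 ->
  qpoch_inf (- q) q * qpoch_inf q (q ^+ 2) = 1.
Proof.
move=> q1; have q2 := cnormX_lt1 q1 (isT : 0 < 2)%N.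
have n0 : qpoch_inf q q != 0 by exact: qpoch_inf_neq0.
apply: (mulfI n0); rewrite mulr1 mulrA -qpoch_inf_opp // mulrC.
by rewrite [in RHS]qpoch_inf_double // -expr2.
Qed.

End QPochhammerLimit.

(** * The q-binomial theorem *)

Section QBinomial.
Variable C : numFieldType.
Implicit Types (A q y w : C) (n k m : nat).

(** The Gaussian binomial coefficient by its Pascal rule, free of division; [qbin_qpoch] recovers
    the quotient formula. *)
Fixpoint qbin q n k : C :=
  match n, k with
  | _, 0%N => 1
  | 0%N, _.+1 => 0
  | n'.+1, k'.+1 => qbin q n' k' + q ^+ k * qbin q n' k
  end.

Lemma qbin0 q n : qbin q n 0 = 1. Proof. by case: n. Qed.

Lemma qbinS q n k : qbin q n.+1 k.+1 = qbin q n k + q ^+ k.+1 * qbin q n k.+1.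
Proof. by []. Qed.

Lemma qbin_small q n k : (n < k)%N -> qbin q n k = 0.
Proof.
elim: n k => [|n IH] [|k] //; rewrite ltnS => nk.
by rewrite qbinS !IH ?mulr0 ?addr0 // ltnW.
Qed.

Lemma qbin_qpoch q k m :
  qbin q (k + m) k * qpoch q q k * qpoch q q m = qpoch q q (k + m).
Proof.
elim: k m => [|k IHk] m; first by rewrite qbin0 qpoch0 !mul1r.
elim: m => [|m IHm].
  have qnn n : qbin q n n = 1.
    by elim: n => [//|n IH]; rewrite qbinS IH qbin_small // mulr0 addr0.
  by rewrite addn0 qnn qpoch0 mul1r mulr1.
have h1 := IHk m.+1; rewrite -addSnnS in h1.
rewrite addnS qbinS [in RHS]qpochS.
have -> : q * q ^+ (k.+1 + m) = q ^+ k.+1 * q ^+ m.+1 by rewrite -exprS -exprD addnS.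
set a := qbin q (k.+1 + m) k in h1 *; set b := qbin q (k.+1 + m) k.+1 in IHm *.
rewrite !qpochS -!exprS in h1 IHm *.
have -> : (a + q ^+ k.+1 * b) * (qpoch q q k * (1 - q ^+ k.+1)) * (qpoch q q m * (1 - q ^+ m.+1))
  = (a * qpoch q q k * (qpoch q q m * (1 - q ^+ m.+1))) * (1 - q ^+ k.+1)
    + q ^+ k.+1 * (1 - q ^+ m.+1) * (b * (qpoch q q k * (1 - q ^+ k.+1)) * qpoch q q m) by ring.
rewrite h1 IHm; ring.
Qed.

(** Rothe's finite q-binomial theorem. [qpochSl] strips the factor 1 - A, so the induction
    hypothesis is used at A q. *)
Lemma qpoch_qbinomial A q n :
  qpoch A q n = \sum_(k < n.+1) (-1) ^+ k * q ^+ 'C(k, 2) * A ^+ k * qbin q n k.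
Proof.
elim: n A => [|n IH] A; first by rewrite qpoch0 big_ord1 qbin0 !expr0 !mulr1.
rewrite qpochSl IH mulrBl mul1r [in RHS]big_ord_recl qbin0 /= expr0 !mulr1.
have -> : \sum_(i < n.+1) (-1) ^+ bump 0 i * q ^+ 'C(bump 0 i, 2) * A ^+ bump 0 i *
      (qbin q n i + q ^+ i.+1 * qbin q n i.+1) =
    \sum_(i < n.+1) ((-1) ^+ i.+1 * q ^+ 'C(i.+1, 2) * (A * q) ^+ i.+1 * qbin q n i.+1) -
    \sum_(i < n.+1) (A * ((-1) ^+ i * q ^+ 'C(i, 2) * (A * q) ^+ i * qbin q n i)).
  rewrite -sumrB; apply: eq_bigr => i _; rewrite /bump /= add1n.
  by rewrite binS bin1 exprD !exprMn !exprS; ring.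
rewrite -big_distrr /= addrA; congr (_ - _).
rewrite [in RHS]big_ord_recr /= qbin_small // mulr0 addr0.
by rewrite big_ord_recl qbin0 /= expr0 !mulr1; congr (_ + _).
Qed.

Lemma bin2_sqr n : (2 * 'C(n, 2) + n = n * n)%N.
Proof. by elim: n => [//|n IH]; rewrite binS bin1; lia. Qed.

Lemma qpochD A q n m : qpoch A q (n + m) = qpoch A q n * qpoch (A * q ^+ n) q m.
Proof.
elim: n A => [|n IH] A; first by rewrite qpoch0 mul1r expr0 mulr1.
by rewrite addSn !qpochSl IH mulrA exprS mulrA.
Qed.

(** Each factor is turned round: with q = y w, 1 - y/q^m = -(y/q^m)(1 - q^m/y), and q^m/y = w
    q^(m-1). *)
Lemma qpoch_rev y w n : y != 0 -> w != 0 -> qpoch (y / (y * w) ^+ n) (y * w) n =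
  (-1) ^+ n * y ^+ n / (y * w) ^+ 'C(n.+1, 2) * qpoch w (y * w) n.
Proof.
move=> y0 w0; have q0 : y * w != 0 by rewrite mulf_neq0.
elim: n => [|n IH]; first by rewrite !qpoch0 !expr0 divr1 !mulr1.
rewrite qpochSl; have -> : y / (y * w) ^+ n.+1 * (y * w) = y / (y * w) ^+ n.
  by rewrite exprS; field; rewrite ?y0 ?w0 ?expf_neq0 ?mulf_neq0.
have eC : 'C(n.+2, 2) = ('C(n.+1, 2) + n.+1)%N by rewrite binS bin1.
rewrite IH qpochS eC exprD [(y * w) ^+ n.+1]exprS.
by rewrite [(-1) ^+ n.+1]exprS [y ^+ n.+1]exprS; field; rewrite ?y0 ?w0 ?expf_neq0 ?mulf_neq0.
Qed.

Lemma qbin_mid q n j : (j <= n)%N -> (forall k, qpoch q q k != 0) ->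
  qbin q (n + n.+1) (n - j) = qpoch q q (n + n.+1) / (qpoch q q (n - j) * qpoch q q (n.+1 + j)).
Proof.
move=> jn h; have e : (n + n.+1 = (n - j) + (n.+1 + j))%N by lia.
by rewrite [in X in _ = X / _]e -qbin_qpoch -e; field; rewrite !h.
Qed.

Lemma qbin_mid_sym q n j : (j <= n)%N -> (forall k, qpoch q q k != 0) ->
  qbin q (n + n.+1) (n.+1 + j) = qbin q (n + n.+1) (n - j).
Proof.
move=> jn h; have e : (n + n.+1 = (n.+1 + j) + (n - j))%N by lia.
rewrite qbin_mid //; have := qbin_qpoch q (n.+1 + j) (n - j); rewrite -e => <-.
by field; rewrite !h.
Qed.

(* With q = y w and z = 1/y, this is the sum of the terms of index k and -k-1 of the
   bilateral series of (-1)^k q^(k(k+1)/2) z^k; negative powers disappear. *)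
Definition theta_term y w k : C :=
  (-1) ^+ k * w ^+ 'C(k.+1, 2) * (y ^+ 'C(k, 2) - y ^+ 'C(k.+2, 2)).

(** Rothe's theorem of length 2n+1 at A = y/q^n. [qpoch_rev] turns the first n factors into (w;
    q)_n, and the indices n - k and n+1+k, which share a q-binomial coefficient, are paired. *)
Lemma jacobi_triple_finite y w n : y != 0 -> w != 0 ->
  (forall k, qpoch (y * w) (y * w) k != 0) ->
  qpoch w (y * w) n * qpoch y (y * w) n.+1 =
  \sum_(k < n.+1) theta_term y w k * qbin (y * w) (n + n.+1) (n - k).
Proof.
move=> y0 w0 h; set q := y * w; have q0 : q != 0 by rewrite mulf_neq0.
have qX k : q ^+ k != 0 by rewrite expf_neq0.
set K := (-1) ^+ n * y ^+ n / q ^+ 'C(n.+1, 2).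
have K0 : K != 0 by rewrite !mulf_neq0 ?expf_neq0 ?invr_eq0 ?oppr_eq0 ?oner_eq0.
apply: (mulfI K0); rewrite mulrA /K -qpoch_rev // -/q.
have := qpochD (y / q ^+ n) q n n.+1; rewrite divfK // => <-.
rewrite qpoch_qbinomial -addSn big_split_ord /= (reindex_inj rev_ord_inj) /=.
rewrite -big_split /= big_distrr /=; apply: eq_bigr => j _.
have : (j <= n)%N by rewrite -ltnS.
move: (nat_of_ord j) => {}j jn; rewrite subSS !addSn -!addSn qbin_mid_sym // /theta_term.
set b := qbin _ _ _.
have -> : w ^+ 'C(j.+1, 2) = q ^+ 'C(j.+1, 2) / y ^+ 'C(j.+1, 2).
  by rewrite exprMn; field; rewrite expf_neq0.
have -> : y ^+ 'C(j.+2, 2) = y ^+ 'C(j.+1, 2) * y ^+ j.+1 by rewrite binS bin1 exprD.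
have -> : y ^+ 'C(j.+1, 2) = y ^+ 'C(j, 2) * y ^+ j by rewrite binS bin1 exprD.
have e1 : q ^+ 'C(n - j, 2) = q ^+ (n * (n - j)) * q ^+ 'C(j.+1, 2) / q ^+ 'C(n.+1, 2).
  apply: (mulIf (qX 'C(n.+1, 2))); rewrite divfK // -!exprD; congr (_ ^+ _).
  by have := bin2_sqr (n - j); have := bin2_sqr n.+1; have := bin2_sqr j.+1; nia.
have e2 : q ^+ 'C(n.+1 + j, 2) = q ^+ (n * (n.+1 + j)) * q ^+ 'C(j.+1, 2) / q ^+ 'C(n.+1, 2).
  apply: (mulIf (qX 'C(n.+1, 2))); rewrite divfK // -!exprD; congr (_ ^+ _).
  by have := bin2_sqr (n.+1 + j); have := bin2_sqr n.+1; have := bin2_sqr j.+1; nia.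
rewrite e1 e2 !expr_div_n -!exprM.
have e3 : (-1) ^+ (n - j) = (-1) ^+ n * (-1) ^+ j :> C.
  by rewrite -{2}(subnK jn) exprD -mulrA -exprMn mulrNN mulr1 expr1n mulr1.
have e4 : y ^+ (n - j) = y ^+ n / y ^+ j.
  by rewrite -{2}(subnK jn) exprD mulfK ?expf_neq0.
rewrite e3 e4 !exprD !exprS; field.
by rewrite !expf_neq0.
Qed.

End QBinomial.

(** * Euler and Jacobi expansions *)

Section ClassicalExpansions.
Variable R : realType.
Local Notation C := (R[i] : numFieldType).
Implicit Types (A q y w : C) (n k : nat).

Lemma cnorm_sign n : cnorm ((-1) ^+ n : C) = 1.
Proof. by rewrite cnormX cnormN cnorm1 expr1n. Qed.

Lemma cnormX_le1 q n : cnorm q <= 1 -> cnorm (q ^+ n) <= 1.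
Proof. by move=> q1; rewrite cnormX exprn_ile1 ?cnorm_ge0. Qed.

Lemma qbin_bound q : cnorm q < 1 ->
  exists2 M : R, 0 <= M & forall n k, cnorm (qbin q n k) <= M.
Proof.
move=> q1; have [||m m0 h] := @qpoch_ge R (cnorm q) (cnorm q); rewrite ?cnorm_ge0 //.
have mV : 0 <= m^-1 by rewrite invr_ge0 ltW.
exists (expR (cnorm q / (1 - cnorm q)) / m / m).
  by rewrite !mulr_ge0 ?expR_ge0.
move=> n k; have [kn|/qbin_small->] := leqP k n; last first.
  by rewrite cnorm0 !mulr_ge0 ?expR_ge0.
have := qbin_qpoch q k (n - k); rewrite subnKC // => e.
have h1 := h q q k (lexx _) (lexx _); have h2 := h q q (n - k)%N (lexx _) (lexx _).
rewrite ler_pdivlMr // ler_pdivlMr //; apply: le_trans (qpoch_le q n q1).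
rewrite -e !cnormM -!mulrA ler_wpM2l ?cnorm_ge0 // ler_pM //; exact: ltW.
Qed.

Lemma qbin_cvg q k : cnorm q < 1 ->
  (fun n => qbin q n k) @ \oo --> (qpoch q q k)^-1.
Proof.
move=> q1; have n0 j : qpoch q q j != 0 by exact: qpoch_neq0.
have i0 : qpoch_inf q q != 0 by exact: qpoch_inf_neq0.
have -> : (qpoch q q k)^-1 = qpoch_inf q q / qpoch_inf q q / qpoch q q k.
  by rewrite divff // mul1r.
apply: (@cvg_trans _ ((fun n => qpoch q q n / qpoch q q (n - k) / qpoch q q k) @ \oo)).
  apply: near_eq_cvg; exists k => // n /= kn.
  have := qbin_qpoch q k (n - k); rewrite subnKC // => <-.
  by field; rewrite !n0.
apply: cvgM (cvg_cst _); apply: cvgM (qpoch_cvg q1) _; apply: (cvgV i0).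
by apply: (cvg_comp_natD (d := k) _ (qpoch_cvg q1)) => n; lia.
Qed.

(** The limit of [qpoch_qbinomial], dominated by a multiple of [cnorm A ^+ k]. *)
Lemma euler_series A q : cnorm A < 1 -> cnorm q < 1 ->
  series (fun k => (-1) ^+ k * q ^+ 'C(k, 2) * A ^+ k / qpoch q q k) @ \oo -->
  qpoch_inf A q.
Proof.
move=> A1 q1; have [M M0 hM] := qbin_bound q1.
have A01 : 0 <= cnorm A < 1 by rewrite cnorm_ge0.
set v := fun k => _.
pose f n k : C := (-1) ^+ k * q ^+ 'C(k, 2) * A ^+ k * qbin q n k.
have hf n k : cnorm (f n k) <= M * cnorm A ^+ k.
  rewrite /f !cnormM cnorm_sign mul1r [cnorm (A ^+ k)]cnormX [leRHS]mulrC.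
  rewrite -[leRHS]mul1r -mulrA ler_pM ?cnorm_ge0 ?mulr_ge0 ?exprn_ge0 ?cnorm_ge0 //.
    by rewrite cnormX_le1 // ltW.
  by rewrite ler_wpM2l ?exprn_ge0 ?cnorm_ge0.
have fv k : (fun n => f n k) @ \oo --> v k.
  by rewrite /f /v; apply: cvgM; [exact: cvg_cst | exact: qbin_cvg].
have hv k : cnorm (v k) <= M * cnorm A ^+ k.
  by apply: cnorm_lim_le (fv k); apply: nearW => n; exact: hf.
have [x vx] := geo_series_cvg A01 hv.
have fs n : series (f n) @ \oo --> qpoch A q n.
  rewrite qpoch_qbinomial; apply: series_fin_cvg => k nk.
  by rewrite /f qbin_small // mulr0.
have h := tannery A01 M0 hf fv fs vx.
by rewrite (cvg_uniq (qpoch_cvg q1) h).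
Qed.

Lemma theta_term_bound y w k : cnorm y <= 1 -> cnorm w < 1 ->
  cnorm (theta_term y w k) <= 2 * cnorm w ^+ k.
Proof.
move=> y1 w1; rewrite /theta_term !cnormM cnorm_sign mul1r mulrC.
apply: ler_pM; rewrite ?cnorm_ge0 //.
  apply: le_trans (cnormB _ _) _; rewrite -[leRHS](_ : 1 + 1 = 2 :> R) //.
  by rewrite lerD // cnormX_le1.
rewrite cnormX; apply: ler_wiXn2l; rewrite ?cnorm_ge0 ?(ltW w1) //.
by rewrite binS bin1 leq_addl.
Qed.

(** In the finite form the q-binomial coefficients tend to 1/(q; q)_oo. The boundary case |y| = 1 is
    kept because psi arises at y = -1. *)
Lemma jacobi_triple y w : y != 0 -> w != 0 -> cnorm y <= 1 -> cnorm w < 1 ->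
  series (theta_term y w) @ \oo -->
  qpoch_inf w (y * w) * qpoch_inf y (y * w) * qpoch_inf (y * w) (y * w).
Proof.
move=> y0 w0 y1 w1; set q := y * w.
have q1 : cnorm q < 1.
  by rewrite cnormM; apply: le_lt_trans w1; rewrite ler_piMl ?cnorm_ge0.
have w01 : 0 <= cnorm w < 1 by rewrite cnorm_ge0.
have [M M0 hM] := qbin_bound q1.
have n0 k : qpoch q q k != 0 by exact: qpoch_neq0.
have i0 : qpoch_inf q q != 0 by exact: qpoch_inf_neq0.
have [x tx] := geo_series_cvg w01 (fun k => theta_term_bound k y1 w1).
(* Beyond n, [n - k] is truncated to 0 and [qbin] there is 1, so these terms have to be cut off
   explicitly. *)
pose f n k : C := if (k <= n)%N then theta_term y w k * qbin q (n + n.+1) (n - k) else 0.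
pose v k : C := theta_term y w k / qpoch_inf q q.
have M20 : 0 <= 2 * M by rewrite mulr_ge0.
have hf n k : cnorm (f n k) <= 2 * M * cnorm w ^+ k.
  rewrite /f; case: ifP => _; last by rewrite cnorm0 mulr_ge0 ?exprn_ge0 ?cnorm_ge0.
  by rewrite cnormM mulrAC ler_pM ?cnorm_ge0 // theta_term_bound.
have fv k : (fun n => f n k) @ \oo --> v k.
  have -> : v k = theta_term y w k * (qpoch_inf q q / (qpoch_inf q q * qpoch_inf q q)).
    by rewrite /v; field.
  apply: (@cvg_trans _ ((fun n => theta_term y w k *
     (qpoch q q (n + n.+1) / (qpoch q q (n - k) * qpoch q q (n.+1 + k)))) @ \oo)).
    by apply: near_eq_cvg; exists k => // n /= kn; rewrite /f kn qbin_mid.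
  apply: cvgM; first exact: cvg_cst.
  apply: cvgM; first by apply: (cvg_comp_nat _ (qpoch_cvg q1)) => n; lia.
  apply: cvgV; first by rewrite mulf_neq0.
  apply: cvgM; first by apply: (cvg_comp_natD (d := k) _ (qpoch_cvg q1)) => n; lia.
  by apply: (cvg_comp_nat _ (qpoch_cvg q1)) => n; lia.
have vx : series v @ \oo --> x / qpoch_inf q q.
  have -> : series v = (fun n => series (theta_term y w) n / qpoch_inf q q).
    by apply/funext => n; rewrite /series /= big_distrl.
  exact: cvgM tx (cvg_cst _).
have fs n : series (f n) @ \oo --> qpoch w q n * qpoch y q n.+1.
  have -> : qpoch w q n * qpoch y q n.+1 = \sum_(k < n.+1) f n k.
    rewrite jacobi_triple_finite //; apply: eq_bigr => k _.
    by rewrite /f -ltnS ltn_ord.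
  by apply: series_fin_cvg => k; rewrite /f ltnNge => /negbTE ->.
have h := tannery w01 M20 hf fv fs vx.
have h' : (fun n => qpoch w q n * qpoch y q n.+1) @ \oo --> qpoch_inf w q * qpoch_inf y q.
  apply: cvgM (qpoch_cvg q1) _.
  exact: cvg_comp_nat (fun n => leqnSn n) (qpoch_cvg q1).
rewrite (cvg_uniq h' h) (divfK i0); exact: tx.
Qed.

End ClassicalExpansions.

(** * The 3-dissection of f_1 f_2 *)

Section Dissection.
Variable R : realType.
Local Notation C := (R[i] : numFieldType).
Implicit Types (q x : C) (n k : nat).

Definition euler_phi q : C := qpoch_inf q q.

(* Ramanujan's phi(-q). *)
Definition theta_phi q : C :=
  qpoch_inf q (q ^+ 2) * qpoch_inf q (q ^+ 2) * qpoch_inf (q ^+ 2) (q ^+ 2).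

(** Ramanujan's psi(q), the sum of q^(k(k+1)/2): half the triple product at y = -1, w = -q. *)
Definition theta_psi q : C := qpoch_inf (- q) q * qpoch_inf (- q) q * qpoch_inf q q.

(** Ramanujan's f(x, x^2); at x = q^3 it collects the exponents of psi(q) divisible by 3. *)
Definition theta_a x : C :=
  qpoch_inf (- x ^+ 2) (x ^+ 3) * qpoch_inf (- x) (x ^+ 3) * qpoch_inf (x ^+ 3) (x ^+ 3).

(** Ramanujan's f(-x, -x^5); at x = q^3, times -2q, it collects the exponents of phi(-q) congruent
    to 1 modulo 3. *)
Definition theta_b x : C :=
  qpoch_inf (x ^+ 5) (x ^+ 6) * qpoch_inf x (x ^+ 6) * qpoch_inf (x ^+ 6) (x ^+ 6).

Lemma theta_term_phiE q k :
  theta_term q q k = (-1) ^+ k * (q ^+ (k * k) - q ^+ (k.+1 * k.+1)).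
Proof.
rewrite /theta_term -mulrA mulrBr -!exprD; congr (_ * (_ ^+ _ - _ ^+ _)).
  by have := bin2_sqr k; have := bin2_sqr k.+1; nia.
by have := bin2_sqr k.+1; have := bin2_sqr k.+2; nia.
Qed.

(** The exponents are (3k+1)^2 - 1 and (3k+2)^2 - 1: squares prime to 3 with one factor q taken
    out. *)
Lemma theta_term_bE q k : theta_term (q ^+ 3) ((q ^+ 3) ^+ 5) k =
  (-1) ^+ k * (q ^+ (9 * (k * k) + 6 * k) - q ^+ (9 * (k * k) + 12 * k + 3)).
Proof.
rewrite /theta_term -mulrA mulrBr -!exprM -!exprD; congr (_ * (_ ^+ _ - _ ^+ _)).
  by have := bin2_sqr k; have := bin2_sqr k.+1; nia.
by have := bin2_sqr k.+1; have := bin2_sqr k.+2; nia.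
Qed.

(** With the next lemma, this clears all signs of [theta_term] when y and w both carry a minus
    sign. *)
Lemma sign_bin2 k : (-1) ^+ k * (-1) ^+ 'C(k.+1, 2) * (-1) ^+ 'C(k, 2) = 1 :> C.
Proof.
rewrite -!exprD.
have -> : (k + 'C(k.+1, 2) + 'C(k, 2) = 2 * 'C(k.+1, 2))%N by rewrite binS bin1; lia.
by rewrite exprM sqrrN expr1n expr1n.
Qed.

Lemma sign_bin2S k : (-1) ^+ k * (-1) ^+ 'C(k.+1, 2) * (-1) ^+ 'C(k.+2, 2) = -1 :> C.
Proof.
rewrite -[LHS]opprK; congr (- _).
by rewrite -[RHS](sign_bin2 k.+1) [(-1) ^+ k.+1]exprS; ring.
Qed.

Lemma theta_term_psiE q k : theta_term (-1) (- q) k = 2 * q ^+ 'C(k.+1, 2).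
Proof.
rewrite /theta_term (exprNn q) mulrBr.
have -> : (-1) ^+ k * ((-1) ^+ 'C(k.+1, 2) * q ^+ 'C(k.+1, 2)) * (-1) ^+ 'C(k, 2) =
  (-1) ^+ k * (-1) ^+ 'C(k.+1, 2) * (-1) ^+ 'C(k, 2) * q ^+ 'C(k.+1, 2) by ring.
have -> : (-1) ^+ k * ((-1) ^+ 'C(k.+1, 2) * q ^+ 'C(k.+1, 2)) * (-1) ^+ 'C(k.+2, 2) =
  (-1) ^+ k * (-1) ^+ 'C(k.+1, 2) * (-1) ^+ 'C(k.+2, 2) * q ^+ 'C(k.+1, 2) by ring.
by rewrite sign_bin2 sign_bin2S; ring.
Qed.

(** Among the triangular numbers of index 3k, 3k+1, 3k+2, the first and the last are the multiples
    of 3. *)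
Lemma theta_term_aE q k : theta_term (- q ^+ 3) (- (q ^+ 3) ^+ 2) k =
  q ^+ 'C((3 * k).+1, 2) + q ^+ 'C((3 * k).+3, 2).
Proof.
rewrite /theta_term (exprNn (q ^+ 3)) (exprNn (q ^+ 3)) (exprNn (_ ^+ 2)) mulrBr.
set s1 := (-1) ^+ k; set s2 := (-1) ^+ _; set s3 := (-1) ^+ _; set s4 := (-1) ^+ _.
set y := q ^+ 3.
have -> : s1 * (s2 * (y ^+ 2) ^+ 'C(k.+1, 2)) * (s3 * y ^+ 'C(k, 2)) -
          s1 * (s2 * (y ^+ 2) ^+ 'C(k.+1, 2)) * (s4 * y ^+ 'C(k.+2, 2)) =
   s1 * s2 * s3 * ((y ^+ 2) ^+ 'C(k.+1, 2) * y ^+ 'C(k, 2)) -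
   s1 * s2 * s4 * ((y ^+ 2) ^+ 'C(k.+1, 2) * y ^+ 'C(k.+2, 2)) by ring.
rewrite sign_bin2 sign_bin2S mul1r mulN1r opprK /y -!exprM -!exprD.
congr (_ ^+ _ + _ ^+ _).
  have := bin2_sqr k; have := bin2_sqr k.+1; have := bin2_sqr (3 * k).+1; nia.
have := bin2_sqr k.+2; have := bin2_sqr k.+1; have := bin2_sqr (3 * k).+3; nia.
Qed.

Lemma series_triple (u : nat -> C) (s : C) : series u @ \oo --> s ->
  series (fun k => u (3 * k)%N + u (3 * k).+1 + u (3 * k).+2) @ \oo --> s.
Proof.
move=> us; have -> : series (fun k => u (3 * k)%N + u (3 * k).+1 + u (3 * k).+2) =
    (fun n => series u (3 * n)%N).
  apply/funext; elim=> [|n IH]; first by rewrite !seriesEnat /= !big_geq.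
  by rewrite mulnS !addSn add0n !seriesSr IH !addrA.
by apply: (cvg_comp_nat _ us) => n; rewrite leq_pmull.
Qed.

Lemma cvg_series_ext (u v : nat -> C) (s : C) :
  u =1 v -> series u @ \oo --> s -> series v @ \oo --> s.
Proof. by move=> /funext ->. Qed.

Lemma cvg_series_lin (u v : nat -> C) (a b s t : C) :
  series u @ \oo --> s -> series v @ \oo --> t ->
  series (fun k => a * u k + b * v k) @ \oo --> a * s + b * t.
Proof.
move=> us vt; have -> : series (fun k => a * u k + b * v k) =
    (fun n => a * series u n + b * series v n).
  by apply/funext => n; rewrite /series /= !big_distrr -big_split.
exact: cvgD (cvgM (cvg_cst _) us) (cvgM (cvg_cst _) vt).
Qed.

Section FixedNome.
Variable q : C.
Hypotheses (q0 : q != 0) (q1 : cnorm q < 1).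

Let qX k : q ^+ k.+1 != 0. Proof. by rewrite expf_neq0. Qed.
Let qXlt k : cnorm (q ^+ k.+1) < 1. Proof. exact: cnormX_lt1. Qed.

Lemma theta_phi_series : series (theta_term q q) @ \oo --> theta_phi q.
Proof. exact: jacobi_triple q0 q0 (ltW q1) q1. Qed.

Lemma theta_psi_series : series (fun k => q ^+ 'C(k.+1, 2)) @ \oo --> theta_psi q.
Proof.
have := @jacobi_triple R (-1) (- q).
rewrite !oppr_eq0 oner_eq0 !cnormN cnorm1 mulrNN mul1r => /(_ isT q0 (lexx _) q1) h.
(* The 1/2 absorbs (-1; q)_oo = 2 (-q; q)_oo. *)
have := cvg_series_lin (a := 1 / 2) (b := 0) h h.
have -> : (fun k => 1 / 2 * theta_term (-1) (- q) k + 0 * theta_term (-1) (- q) k) =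
    (fun k => q ^+ 'C(k.+1, 2)).
  by apply/funext => k; rewrite theta_term_psiE; field.
have -> : 1 / 2 * (qpoch_inf (- q) q * qpoch_inf (-1) q * qpoch_inf q q) +
    0 * (qpoch_inf (- q) q * qpoch_inf (-1) q * qpoch_inf q q) = theta_psi q.
  by rewrite /theta_psi (@qpoch_infS R (-1)) // mulN1r; field.
exact: id.
Qed.

Lemma theta_b_series :
  series (theta_term (q ^+ 3) ((q ^+ 3) ^+ 5)) @ \oo --> theta_b (q ^+ 3).
Proof.
by have := jacobi_triple (qX 2) (expf_neq0 5 (qX 2)) (ltW (qXlt 2))
  (cnormX_lt1 (qXlt 2) (isT : 0 < 5)%N); rewrite -exprS; exact: id.
Qed.

Lemma theta_a_series :
  series (theta_term (- q ^+ 3) (- (q ^+ 3) ^+ 2)) @ \oo --> theta_a (q ^+ 3).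
Proof.
have := @jacobi_triple R (- q ^+ 3) (- (q ^+ 3) ^+ 2).
rewrite !oppr_eq0 !cnormN mulrNN -exprS.
by move=> /(_ (qX 2) (expf_neq0 2 (qX 2)) (ltW (qXlt 2))
  (cnormX_lt1 (qXlt 2) (isT : 0 < 2)%N)); exact: id.
Qed.

End FixedNome.

(** In a block of three terms, q^((3k+1)^2) and q^((3k+2)^2) each occur twice, hence the 2; the
    outer powers form phi(-q^9). *)
Lemma theta_phi_dissect q : q != 0 -> cnorm q < 1 ->
  theta_phi q = theta_phi (q ^+ 9) - 2 * q * theta_b (q ^+ 3).
Proof.
move=> q0 q1; have h := series_triple (theta_phi_series q0 q1).
have q9 := cnormX_lt1 q1 (isT : 0 < 9)%N.
have := cvg_series_lin (a := 1) (b := - (2 * q))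
  (theta_phi_series (expf_neq0 9 q0) q9) (theta_b_series q0 q1).
rewrite mul1r mulNr => h'; apply: cvg_uniq h _; apply: cvg_series_ext h' => k.
rewrite !theta_term_phiE theta_term_bE.
have s1 : (-1) ^+ (3 * k) = (-1) ^+ k :> C.
  by rewrite exprM (_ : (-1) ^+ 3 = -1 :> C) //; ring.
rewrite [(-1) ^+ (3 * k).+2]exprS [(-1) ^+ (3 * k).+1]exprS s1.
have -> : ((3 * k) * (3 * k) = 9 * (k * k))%N by nia.
have -> : ((3 * k).+1 * (3 * k).+1 = (9 * (k * k) + 6 * k).+1)%N by nia.
have -> : ((3 * k).+2 * (3 * k).+2 = (9 * (k * k) + 12 * k + 3).+1)%N by nia.
have -> : ((3 * k).+3 * (3 * k).+3 = 9 * (k.+1 * k.+1))%N by nia.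
rewrite -!exprM [q ^+ (9 * (k * k) + 6 * k).+1]exprS.
by rewrite [q ^+ (9 * (k * k) + 12 * k + 3).+1]exprS; ring.
Qed.

Lemma theta_psi_dissect q : q != 0 -> cnorm q < 1 ->
  theta_psi q = theta_a (q ^+ 3) + q * theta_psi (q ^+ 9).
Proof.
move=> q0 q1; have h := series_triple (theta_psi_series q0 q1).
have q9 := cnormX_lt1 q1 (isT : 0 < 9)%N.
have := cvg_series_lin (a := 1) (b := q) (theta_a_series q0 q1) (theta_psi_series (expf_neq0 9 q0) q9).
rewrite mul1r => h'; apply: cvg_uniq h _; apply: cvg_series_ext h' => k.
rewrite theta_term_aE -exprM -exprS mul1r addrAC; congr (_ + _ ^+ _ + _).
by have := bin2_sqr k.+1; have := bin2_sqr (3 * k).+2; nia.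
Qed.

Lemma theta_phi_psi q : cnorm q < 1 ->
  theta_phi q * theta_psi q = euler_phi q * euler_phi (q ^+ 2).
Proof.
move=> q1; have h := qpoch_inf_odd_distinct q1; rewrite /theta_phi /theta_psi /euler_phi.
set a := qpoch_inf (- q) q in h *; set b := qpoch_inf q (q ^+ 2) in h *.
set c := qpoch_inf (q ^+ 2) _; set d := qpoch_inf q q.
have -> : b * b * c * (a * a * d) = (a * b) * (a * b) * (d * c) by ring.
by rewrite h !mul1r.
Qed.

(** Put a_i = (x^i; x^6)_oo and m_i = (-x^i; x^3)_oo. Splitting (x^2; x^6)_oo and (x^4; x^6)_oo
    gives a_2 = a_1 a_4 m_1 and a_4 = a_2 a_5 m_2; multiplied together, they leave a_1 a_5 m_1 m_2 =
    1. *)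
Lemma theta_ab x : cnorm x < 1 ->
  theta_a x * theta_b x = euler_phi (x ^+ 3) * euler_phi (x ^+ 6).
Proof.
move=> x1; have x3 := cnormX_lt1 x1 (isT : 0 < 3)%N.
have x6 := cnormX_lt1 x1 (isT : 0 < 6)%N.
have n0 k : qpoch_inf (x ^+ k.+1) (x ^+ 6) != 0.
  by apply: qpoch_inf_neq0 => //; exact: cnormX_lt1.
have e2 := @qpoch_inf_opp R x (x ^+ 3) x3.
have e4 := @qpoch_inf_opp R (x ^+ 2) (x ^+ 3) x3.
have d1 := @qpoch_inf_double R x (x ^+ 3) x3.
have d2 := @qpoch_inf_double R (x ^+ 2) (x ^+ 3) x3.
rewrite -!exprM /= -?exprS -?exprD /= in e2 e4 d1 d2.
rewrite d1 in e2; rewrite d2 in e4; rewrite /theta_a /theta_b /euler_phi.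
have cancel (a1 a2 a4 a5 m1 m2 c d : C) : a2 != 0 -> a4 != 0 ->
    a2 = a1 * a4 * m1 -> a4 = a2 * a5 * m2 -> m2 * m1 * c * (a5 * a1 * d) = c * d.
  move=> n2 n4 h2 h4; suff -> : m2 * m1 * c * (a5 * a1 * d) = c * d * (m1 * a1 * m2 * a5).
    have -> : m1 * a1 * m2 * a5 = 1; last by rewrite mulr1.
    apply: (mulfI (mulf_neq0 n2 n4)); rewrite mulr1.
    transitivity ((a1 * a4 * m1) * (a2 * a5 * m2)); first by ring.
    by rewrite -h2 -h4.
  by ring.
exact: cancel (n0 1%N) (n0 3%N) e2 e4.
Qed.

(** In (p - 2 q b)(a + q s) the residue 1 part is q p s - 2 q a b. Both a b and p s equal the same
    product of two [euler_phi], so it collapses to -q p s. *)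
Lemma euler_phi_dissect q : q != 0 -> cnorm q < 1 ->
  euler_phi q * euler_phi (q ^+ 2) =
  theta_phi ((q ^+ 3) ^+ 3) * theta_a (q ^+ 3)
  - q * (euler_phi ((q ^+ 3) ^+ 3) * euler_phi ((q ^+ 3) ^+ 6))
  - 2 * q ^+ 2 * (theta_b (q ^+ 3) * theta_psi ((q ^+ 3) ^+ 3)).
Proof.
move=> q0 q1; have x1 := cnormX_lt1 q1 (isT : 0 < 3)%N.
have x3 := cnormX_lt1 x1 (isT : 0 < 3)%N.
rewrite -theta_phi_psi // theta_phi_dissect // theta_psi_dissect //.
have hab := theta_ab x1; have hpp := theta_phi_psi x3.
have e6 : (q ^+ 3) ^+ 6 = ((q ^+ 3) ^+ 3) ^+ 2 by rewrite -!exprM.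
have -> : q ^+ 9 = (q ^+ 3) ^+ 3 by rewrite -exprM.
rewrite {1}e6 -hpp; rewrite e6 -hpp in hab.
have alg (p a b s : C) : a * b = p * s -> (p - 2 * q * b) * (a + q * s) =
    p * a - q * (p * s) - 2 * q ^+ 2 * (b * s).
  move=> h; have -> : (p - 2 * q * b) * (a + q * s) =
    p * a + q * (p * s) - 2 * q * (a * b) - 2 * q ^+ 2 * (b * s) by ring.
  by rewrite h; ring.
exact: alg hab.
Qed.

End Dissection.

(** * A summation by the WZ method *)

Section WZPair.
Variable C : numFieldType.
Implicit Types (Q a : C) (n k : nat).

(* The factor a^n (Q^2/a; Q^2)_n is written as the product of the a - Q^(2j+2), which
   makes sense at a = 0. *)
Definition chern_term Q a n : C :=
  (-1) ^+ n * Q ^+ ('C(n, 2) + n) * qpoch a Q n * \prod_(j < n) (a - Q ^+ (2 * j.+1))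
  / (qpoch (Q ^+ 3) (Q ^+ 3) n * qpoch (a ^+ 2 * Q) (Q ^+ 2) n).

(** The term ratio, rational in x = Q^n, so that the WZ checks become identities for [field]. *)
Definition chern_ratio Q a (x : C) : C :=
  - (x * Q) * (1 - a * x) * (a - (Q * x) ^+ 2)
  / ((1 - (Q * x) ^+ 3) * (1 - a ^+ 2 * Q * x ^+ 2)).

Lemma chern_term0 Q a : chern_term Q a 0 = 1.
Proof. by rewrite /chern_term !qpoch0 big_ord0 !expr0 !mulr1 divr1. Qed.

Lemma chern_termS Q a n :
  chern_term Q a n.+1 = chern_term Q a n * chern_ratio Q a (Q ^+ n).
Proof.
rewrite /chern_term /chern_ratio !qpochS big_ord_recr /=.
have -> : Q ^+ ('C(n.+1, 2) + n.+1) = Q ^+ ('C(n, 2) + n) * (Q * Q ^+ n).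
  by rewrite binS bin1 exprD exprS.
have -> : Q ^+ (2 * n.+1) = (Q * Q ^+ n) ^+ 2 by rewrite mulnC exprM [Q ^+ n.+1]exprS.
rewrite [(Q ^+ 3) ^+ n]exprAC [(Q ^+ 2) ^+ n]exprAC [(-1) ^+ n.+1]exprS -exprMn.
by rewrite !invfM; ring.
Qed.

(** The quotient X(a Q^2)/X(a) read off from the product formula. *)
Definition wz_rho Q a : C :=
  (1 - a ^+ 2 * Q) * (1 - a ^+ 2 * Q ^+ 3) / ((1 - a * Q) * (1 - a ^+ 3 * Q ^+ 3)).

(** The ratio of the terms at a Q^2 and at a, divided by rho, as a function of x = Q^n. Its
    denominator [a - x ^+ 2] is why a must avoid the even powers of Q. *)
Definition wz_quot Q a (x : C) : C :=
  - x ^+ 2 * (1 - a * x) * (1 - a * Q * x) * (1 - a ^+ 3 * Q ^+ 3)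
  / ((a - x ^+ 2) * (1 - a ^+ 2 * Q * x ^+ 2) * (1 - a ^+ 2 * Q ^+ 3 * x ^+ 2)).

Definition wz_cert Q a (x : C) : C :=
  - (a * x * Q) * (1 - a * x) * (1 - a * Q ^+ 2 * x)
  / ((1 - a ^+ 2 * Q * x ^+ 2) * (1 - a ^+ 2 * Q ^+ 3 * x ^+ 2)).

Section Certificate.
Variables Q a : C.
Hypothesis aQ_neq : forall k, a != Q ^+ (2 * k).
Hypothesis Q3_neq : forall k, 1 - (Q ^+ k.+1) ^+ 3 != 0.
Hypothesis a2_neq : forall k, 1 - a ^+ 2 * Q ^+ (2 * k).+1 != 0.
Hypothesis aQ1 : 1 - a * Q != 0.
Hypothesis aQ3 : 1 - (a * Q) ^+ 3 != 0.

Let ax n : a - (Q ^+ n) ^+ 2 != 0.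
Proof. by rewrite subr_eq0 -exprM mulnC aQ_neq. Qed.
Let a2x n : 1 - a ^+ 2 * Q * (Q ^+ n) ^+ 2 != 0.
Proof. by rewrite -mulrA -exprM mulnC -exprS a2_neq. Qed.
Let a2Q3x n : 1 - a ^+ 2 * Q ^+ 3 * (Q ^+ n) ^+ 2 != 0.
Proof.
have -> : a ^+ 2 * Q ^+ 3 * (Q ^+ n) ^+ 2 = a ^+ 2 * Q * (Q ^+ n.+1) ^+ 2.
  by rewrite [Q ^+ n.+1]exprS; ring.
exact: a2x.
Qed.

Let nz n : [&& a - (Q ^+ n) ^+ 2 != 0, 1 - a ^+ 2 * Q * (Q ^+ n) ^+ 2 != 0,
    1 - a ^+ 2 * Q ^+ 3 * (Q ^+ n) ^+ 2 != 0, a - (Q * Q ^+ n) ^+ 2 != 0,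
    1 - a ^+ 2 * Q * (Q * Q ^+ n) ^+ 2 != 0,
    1 - a ^+ 2 * Q ^+ 3 * (Q * Q ^+ n) ^+ 2 != 0 & 1 - (Q * Q ^+ n) ^+ 3 != 0].
Proof. by rewrite -[Q * _]exprS !ax !a2x !a2Q3x Q3_neq. Qed.

Let nz0 : [&& a - 1 != 0, 1 - a ^+ 2 * Q != 0 & 1 - a ^+ 2 * Q ^+ 3 != 0].
Proof. by have := nz 0; rewrite !expr0 !expr1n !mulr1 => /and4P[-> -> -> _]. Qed.

Lemma chern_term_shift n :
  chern_term Q (a * Q ^+ 2) n = wz_rho Q a * wz_quot Q a (Q ^+ n) * chern_term Q a n.
Proof.
elim: n => [|n IH].
  rewrite !chern_term0 /wz_rho /wz_quot expr0; field.
  by case/and3P: nz0 => -> -> ->; rewrite aQ1 aQ3.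
rewrite !chern_termS IH /chern_ratio /wz_rho /wz_quot [Q ^+ n.+1]exprS.
move: (chern_term Q a n) (Q ^+ n) (nz n) => t x.
case/and5P=> h1 h2 h3 h4 /and3P[h5 h6 h7].
by field; rewrite aQ1 aQ3 h1 h2 h4 h5 h6 h7.
Qed.

(** The summed form of the WZ equation. It already holds at n = 0, so there is no lower boundary
    term, and the right-hand side is the only remainder. *)
Lemma wz_telescope n :
  \sum_(k < n.+1) (wz_quot Q a (Q ^+ k) * chern_term Q a k - chern_term Q a k) =
  wz_cert Q a (Q ^+ n) * chern_term Q a n.
Proof.
elim: n => [|n IH].
  rewrite big_ord1 chern_term0 /wz_cert /wz_quot expr0; field.
  by case/and3P: nz0 => -> -> ->.
rewrite big_ord_recr /= IH chern_termS /wz_cert /wz_quot /chern_ratio [Q ^+ n.+1]exprS.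
move: (chern_term Q a n) (Q ^+ n) (nz n) => t x.
case/and5P=> h1 h2 h3 h4 /and3P[h5 h6 h7].
by field; rewrite ?h1 ?h2 ?h3 h4 h5 h6 h7.
Qed.

End Certificate.
End WZPair.

(** * The closed form of X(a) *)

Section ChernSum.
Variable R : realType.
Local Notation C := (R[i] : numFieldType).
Variables Q a : C.
Hypotheses (Q1 : cnorm Q < 1) (a1 : cnorm a < 1).
Hypothesis aQ_neq : forall j k, a * Q ^+ (2 * j) != Q ^+ (2 * k).

Let Qk k : cnorm (Q ^+ k.+1) < 1. Proof. exact: cnormX_lt1. Qed.
Let Q01 : 0 <= cnorm Q < 1. Proof. by rewrite cnorm_ge0. Qed.

Lemma one_sub_neq0 (x : C) : cnorm x < 1 -> 1 - x != 0.
Proof.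
by move=> x1; rewrite subr_eq0; apply: contraTneq x1 => <-; rewrite cnorm1 ltxx.
Qed.

Lemma cnormM_lt1 (x y : C) : cnorm x < 1 -> cnorm y <= 1 -> cnorm (x * y) < 1.
Proof.
move=> x1 y1; rewrite cnormM; apply: le_lt_trans x1.
by rewrite ler_piMr ?cnorm_ge0.
Qed.

(** Uniform in b, since b will run through a Q^(2k) towards 0. The decay comes from Q^(C(n,2)+n);
    the other factors stay bounded. *)
Lemma chern_term_bound : exists2 M : R, 0 <= M &
  forall b n, cnorm b <= 1 -> cnorm (chern_term Q b n) <= M * cnorm Q ^+ n.
Proof.
have [m m0 hm] := qpoch_ge Q01 Q01; have mV : 0 <= m^-1 by rewrite invr_ge0 ltW.
have Q2 : 0 <= cnorm (Q ^+ 2) < 1 by rewrite cnorm_ge0 Qk.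
have Qi : 0 <= (1 - cnorm Q)^-1 by rewrite invr_ge0 subr_ge0 ltW.
have QX k : cnorm (Q ^+ k.+1) <= cnorm Q.
  by rewrite exprS cnormM ler_piMr ?cnorm_ge0 // cnormX_le1 // ltW.
pose E1 : R := expR (1 / (1 - cnorm Q)); pose E2 : R := expR (1 / (1 - cnorm (Q ^+ 2))).
exists (E1 * E2 * (m^-1 * m^-1)); first by rewrite !mulr_ge0 ?expR_ge0.
move=> b n b1; rewrite /chern_term !cnormM cnorm_sign mul1r cnormV cnormM invfM.
have h1 : cnorm (qpoch b Q n) <= E1.
  by apply: le_trans (qpoch_le _ _ Q1) _; rewrite ler_expR ler_wpM2r.
have h2 : cnorm (\prod_(j < n) (b - Q ^+ (2 * j.+1))) <= E2.
  apply: (@cnorm_prod_le R (fun j => b - Q ^+ (2 * j.+1)) 1) => // k.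
  apply: le_trans (cnormB _ _) _; rewrite lerD // mul1r.
  by rewrite mulnS exprD cnormM exprM !cnormX ler_piMl ?exprn_ge0 ?cnorm_ge0 // exprn_ile1 ?cnorm_ge0 // ltW.
have h3 : (cnorm (qpoch (Q ^+ 3) (Q ^+ 3) n))^-1 <= m^-1.
  have h := hm _ _ n (QX 2%N) (QX 2%N).
  by rewrite lef_pV2 ?posrE //; apply: lt_le_trans h.
have h4 : (cnorm (qpoch (b ^+ 2 * Q) (Q ^+ 2) n))^-1 <= m^-1.
  have hb : cnorm (b ^+ 2 * Q) <= cnorm Q.
    by rewrite cnormM ler_piMl ?cnorm_ge0 // cnormX_le1.
  have h := hm _ _ n hb (QX 1%N).
  by rewrite lef_pV2 ?posrE //; apply: lt_le_trans h.
have h5 : cnorm (Q ^+ ('C(n, 2) + n)) <= cnorm Q ^+ n.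
  by rewrite cnormX ler_wiXn2l ?cnorm_ge0 ?(ltW Q1) // leq_addl.
rewrite [leRHS](_ : _ = cnorm Q ^+ n * E1 * E2 * (m^-1 * m^-1)); last by ring.
apply: ler_pM.
- by rewrite !mulr_ge0 ?cnorm_ge0.
- by rewrite mulr_ge0 ?invr_ge0 ?cnorm_ge0.
- apply: ler_pM; rewrite ?mulr_ge0 ?cnorm_ge0 //.
  by apply: ler_pM; rewrite ?cnorm_ge0.
- by apply: ler_pM; rewrite ?invr_ge0 ?cnorm_ge0.
Qed.

Lemma chern_series_cvg b : cnorm b <= 1 ->
  series (chern_term Q b) @ \oo --> series_sum (chern_term Q b).
Proof.
move=> b1; have [M M0 hM] := chern_term_bound.
have [s hs] := geo_series_cvg Q01 (fun n => hM b n b1).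
by rewrite /series_sum (limnE hs).
Qed.

Lemma pow_cvg0 (x : C) : cnorm x < 1 -> (fun n => x ^+ n) @ \oo --> (0 : C).
Proof.
move=> x1; apply: (@cvg_cnorm_le _ _ _ (fun n => 1 * cnorm x ^+ n)).
  by apply: nearW => n; rewrite subr0 cnormX mul1r.
by apply: geo_cvg0; rewrite cnorm_ge0.
Qed.

(** In the limit of [wz_telescope] the remainder vanishes: the terms tend to 0 and the certificate
    has a finite limit at x = 0. *)
Lemma chern_sum_shift b : cnorm b < 1 -> (forall k, b != Q ^+ (2 * k)) ->
  series_sum (chern_term Q (b * Q ^+ 2)) = wz_rho Q b * series_sum (chern_term Q b).
Proof.
move=> b1 bQ; have b2 : cnorm (b ^+ 2) < 1 by exact: cnormX_lt1.
have bQ1 : 1 - b * Q != 0 by apply: one_sub_neq0; apply: cnormM_lt1 => //; exact: ltW.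
have bQ3 : 1 - (b * Q) ^+ 3 != 0.
  by apply: one_sub_neq0; apply: cnormX_lt1 => //; apply: cnormM_lt1 => //; exact: ltW.
have Q3 k : 1 - (Q ^+ k.+1) ^+ 3 != 0 by apply: one_sub_neq0; apply: cnormX_lt1.
have bQk k : 1 - b ^+ 2 * Q ^+ (2 * k).+1 != 0.
  by apply: one_sub_neq0; apply: cnormM_lt1 => //; exact: ltW.
have cb := chern_series_cvg (ltW b1).
have cb' : series (chern_term Q (b * Q ^+ 2)) @ \oo --> series_sum (chern_term Q (b * Q ^+ 2)).
  by apply: chern_series_cvg; apply: ltW; apply: cnormM_lt1 => //; exact: ltW.
set s := series_sum _ in cb' *; set t := series_sum _ in cb *.
have rho0 : wz_rho Q b != 0.
  rewrite mulf_neq0 ?invr_eq0 ?mulf_neq0 //.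
  - by have := bQk 0; rewrite expr1.
  - by have := bQk 1; rewrite muln1.
  - by rewrite -exprMn.
suff h : (wz_rho Q b)^-1 * s - t = 0.
  by move/eqP: h; rewrite subr_eq0 => /eqP <-; rewrite mulVKf.
pose u n := (wz_rho Q b)^-1 * series (chern_term Q (b * Q ^+ 2)) n - series (chern_term Q b) n.
have hu : (fun n => u n.+1) @ \oo --> (wz_rho Q b)^-1 * s - t.
  apply: (cvg_comp_nat (fun n => leqnSn n)).
  exact: cvgB (cvgM (cvg_cst _) cb') cb.
apply: cvg_uniq hu _.
have -> : (fun n => u n.+1) = (fun n => wz_cert Q b (Q ^+ n) * chern_term Q b n).
  apply/funext => n; rewrite -wz_telescope // /u /series /= big_distrr -sumrB big_mkord.
  apply: eq_bigr => k _; rewrite chern_term_shift //.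
  by congr (_ - _); rewrite -mulrA; exact: mulKf.
have [M M0 hM] := chern_term_bound.
have t0 : chern_term Q b @ \oo --> (0 : C).
  apply: (@cvg_cnorm_le _ _ _ (fun n => M * cnorm Q ^+ n)); last exact: geo_cvg0.
  by apply: nearW => n; rewrite subr0 hM // ltW.
have x0 := pow_cvg0 Q1.
have c0 : (fun n => wz_cert Q b (Q ^+ n)) @ \oo --> wz_cert Q b 0.
  have x2 : (fun n => (Q ^+ n) ^+ 2) @ \oo --> (0 : C) ^+ 2 by exact: (cvgM x0 x0).
  rewrite /wz_cert; apply: cvgM.
    apply: cvgM; first apply: cvgM.
    - by apply: cvgN; apply: cvgM (cvg_cst _); apply: cvgM (cvg_cst _) x0.
    - exact: cvgB (cvg_cst _) (cvgM (cvg_cst _) x0).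
    - exact: cvgB (cvg_cst _) (cvgM (cvg_cst _) x0).
  apply: cvgV; first by rewrite !expr0n !mulr0 !subr0 mulr1 oner_eq0.
  apply: cvgM; exact: cvgB (cvg_cst _) (cvgM (cvg_cst _) x2).
rewrite -(mulr0 (wz_cert Q b 0)); exact: (cvgM c0 t0).
Qed.

(** Induction through the term ratio reduces this to continuity at a = 0 of a rational function. *)
Lemma chern_term_cvg0 (b : nat -> C) n : b @ \oo --> (0 : C) ->
  (fun k => chern_term Q (b k) n) @ \oo --> chern_term Q 0 n.
Proof.
move=> b0; elim: n => [|n IH].
  by rewrite chern_term0; under eq_fun do rewrite chern_term0; exact: cvg_cst.
rewrite chern_termS; under eq_fun do rewrite chern_termS.
apply: cvgM IH _; rewrite /chern_ratio; set x := Q ^+ n.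
have b2 : (fun k => b k ^+ 2) @ \oo --> (0 : C) ^+ 2 by exact: (cvgM b0 b0).
apply: cvgM.
  apply: cvgM; last exact: cvgB b0 (cvg_cst _).
  apply: cvgM; first exact: cvg_cst.
  exact: cvgB (cvg_cst _) (cvgM b0 (cvg_cst _)).
apply: cvgV.
  rewrite expr0n !mul0r subr0 mulr1; apply: one_sub_neq0.
  by apply: cnormX_lt1 => //; rewrite /x -exprS.
apply: cvgM; first exact: cvg_cst.
exact: cvgB (cvg_cst _) (cvgM (cvgM b2 (cvg_cst _)) (cvg_cst _)).
Qed.

(** At a = 0 the product contributes (-1)^n Q^(n(n+1)), which combines with the power of Q into base
    Q^3: Euler's series at A = -Q^3. *)
Lemma chern_term_at0 n : chern_term Q 0 n =
  (-1) ^+ n * (Q ^+ 3) ^+ 'C(n, 2) * (- Q ^+ 3) ^+ n / qpoch (Q ^+ 3) (Q ^+ 3) n.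
Proof.
have p1 (x : C) k : qpoch 0 x k = 1.
  by rewrite /qpoch big1 // => j _; rewrite mul0r subr0.
rewrite /chern_term expr0n mul0r !p1 !mulr1; congr (_ / _); rewrite -!mulrA; congr (_ * _).
elim: n => [|n IH]; first by rewrite big_ord0 !expr0 !mulr1.
rewrite big_ord_recr /= [(- Q ^+ 3) ^+ n.+1]exprS.
have -> : (Q ^+ 3) ^+ 'C(n.+1, 2) = (Q ^+ 3) ^+ 'C(n, 2) * (Q ^+ 3) ^+ n.
  by rewrite binS bin1 exprD.
have -> : Q ^+ ('C(n.+1, 2) + n.+1) = Q ^+ ('C(n, 2) + n) * (Q * Q ^+ n).
  by rewrite binS bin1 exprD exprS.
have -> : Q ^+ (2 * n.+1) = (Q * Q ^+ n) ^+ 2 by rewrite mulnC exprM [Q ^+ n.+1]exprS.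
rewrite (exprAC Q 3 n); move: IH.
move: (Q ^+ ('C(n, 2) + n)) (\prod_(i < n) _) (Q ^+ n) ((Q ^+ 3) ^+ 'C(n, 2)) ((- Q ^+ 3) ^+ n).
move=> A P x B D IH; transitivity (A * P * - (Q * x) ^+ 3); first by ring.
by rewrite IH; ring.
Qed.

(** Cleared of denominators. The length [k.*2] reflects the two numerator factors of rho at each
    shift; the orbit a Q^(2k) is why [aQ_neq] quantifies over j. *)
Lemma chern_sum_iter k : series_sum (chern_term Q (a * (Q ^+ 2) ^+ k)) *
  (qpoch (a * Q) (Q ^+ 2) k * qpoch (a ^+ 3 * Q ^+ 3) (Q ^+ 6) k) =
  series_sum (chern_term Q a) * qpoch (a ^+ 2 * Q) (Q ^+ 2) k.*2.
Proof.
elim: k => [|k IH]; first by rewrite expr0 mulr1 !qpoch0 !mulr1.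
have ak : cnorm (a * (Q ^+ 2) ^+ k) < 1.
  by apply: cnormM_lt1 => //; rewrite cnormX_le1 // ltW.
have aj j : a * (Q ^+ 2) ^+ k != Q ^+ (2 * j) by rewrite -exprM aQ_neq.
rewrite [(Q ^+ 2) ^+ k.+1]exprSr [a * (_ * _)]mulrA chern_sum_shift // doubleS !qpochS.
set s := series_sum _ in IH *; set t := series_sum _ in IH *.
rewrite [RHS]mulrA [t * _]mulrA -IH /wz_rho.
have e1 : (a * (Q ^+ 2) ^+ k) ^+ 2 * Q = a ^+ 2 * Q * (Q ^+ 2) ^+ k.*2.
  by rewrite -addnn exprD; ring.
have e2 : (a * (Q ^+ 2) ^+ k) ^+ 2 * Q ^+ 3 = a ^+ 2 * Q * (Q ^+ 2) ^+ k.*2.+1.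
  by rewrite [_ ^+ k.*2.+1]exprS -addnn exprD; ring.
have e3 : (a * (Q ^+ 2) ^+ k) ^+ 3 * Q ^+ 3 = a ^+ 3 * Q ^+ 3 * (Q ^+ 6) ^+ k.
  by rewrite exprMn mulrAC -!exprM; congr (_ * _ * _ ^+ _); lia.
rewrite e1 e2 e3 [a * _ * Q]mulrAC.
have n1 : 1 - a * Q * (Q ^+ 2) ^+ k != 0.
  rewrite mulrAC; apply: one_sub_neq0; apply: cnormM_lt1 => //; exact: ltW.
have n2 : 1 - a ^+ 3 * Q ^+ 3 * (Q ^+ 6) ^+ k != 0.
  rewrite -e3; apply: one_sub_neq0; apply: cnormM_lt1; first exact: cnormX_lt1.
  by apply: cnormX_le1; apply: ltW.
move: (1 - a * Q * _) (1 - a ^+ 3 * _ * _) n1 n2 => d1 d2 n1 n2.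
by field; rewrite n1 n2.
Qed.

Theorem chern_sum : series_sum (chern_term Q a) * qpoch_inf (a ^+ 2 * Q) (Q ^+ 2) =
  qpoch_inf (- Q ^+ 3) (Q ^+ 3) *
  (qpoch_inf (a * Q) (Q ^+ 2) * qpoch_inf (a ^+ 3 * Q ^+ 3) (Q ^+ 6)).
Proof.
have Q2 := Qk 1; have Q3 := Qk 2; have Q6 := Qk 5.
have [M M0 hM] := chern_term_bound.
have ak k : cnorm (a * (Q ^+ 2) ^+ k) <= 1.
  by apply: ltW; apply: cnormM_lt1 => //; rewrite cnormX_le1 // ltW.
have a0 : (fun k => a * (Q ^+ 2) ^+ k) @ \oo --> (0 : C).
  by rewrite -(mulr0 a); exact: (cvgM (cvg_cst a) (pow_cvg0 Q2)).
have v0 : series (chern_term Q 0) @ \oo --> qpoch_inf (- Q ^+ 3) (Q ^+ 3).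
  rewrite (funext chern_term_at0); apply: euler_series => //.
  by rewrite cnormN.
have h := tannery Q01 M0 (fun k n => hM _ n (ak k))
  (fun n => chern_term_cvg0 (n := n) a0) (fun k => chern_series_cvg (ak k)) v0.
apply: (cvg_uniq (u := fun k => series_sum (chern_term Q a) * qpoch (a ^+ 2 * Q) (Q ^+ 2) k.*2)).
  apply: cvgM; first exact: cvg_cst.
  by apply: (cvg_comp_nat _ (qpoch_cvg Q2)) => n; rewrite -addnn leq_addr.
under eq_fun do rewrite -chern_sum_iter.
exact: cvgM h (cvgM (qpoch_cvg Q2) (qpoch_cvg Q6)).
Qed.

End ChernSum.

(** * Power series *)

Section CauchyProduct.
Variable K : comPzRingType.
Implicit Types u v : nat -> K.

Definition cauchy_prod u v k : K := \sum_(i < k.+1) u i * v (k - i)%N.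

Lemma sum_cauchy_prod u v n :
  \sum_(k < n) cauchy_prod u v k = \sum_(i < n) u i * \sum_(j < n - i) v j.
Proof.
elim: n => [|n IH]; first by rewrite !big_ord0.
rewrite big_ord_recr /= IH [RHS]big_ord_recr /= subSnn big_ord1.
rewrite /cauchy_prod big_ord_recr /= subnn addrA; congr (_ + _).
rewrite -big_split /=; apply: eq_bigr => i _.
by rewrite subSn ?(ltnW (ltn_ord i)) // big_ord_recr /= mulrDr.
Qed.

Lemma cauchy_prod_scale u v (q : K) k :
  cauchy_prod u v k * q ^+ k = cauchy_prod (fun i => u i * q ^+ i) (fun i => v i * q ^+ i) k.
Proof.
rewrite /cauchy_prod big_distrl /=; apply: eq_bigr => i _.
by rewrite -[X in _ ^+ X](@subnK i k) -1?ltnS // addnC exprD mulrACA.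
Qed.

End CauchyProduct.

Section PowerSeries.
Variable R : realType.
Local Notation C := (R[i] : numFieldType).
Implicit Types (f g : C -> C) (b c d : nat -> C) (q : C) (r : R).

(** Unlike in [laurent_expansion], q = 0 is included. *)
Definition has_pseries f b : Prop :=
  forall q, cnorm q < 1 -> series (fun k => b k * q ^+ k) @ \oo --> f q.

Lemma cvg_cnorm_bounded (u : nat -> C) (x : C) : u @ \oo --> x ->
  exists2 M : R, 0 <= M & forall n, cnorm (u n) <= M.
Proof.
move=> /cvg_cnormP /(_ 1 ltr01) [N _ hN].
have S0 : 0 <= \sum_(k < N) cnorm (u k) by apply: sumr_ge0 => k _; exact: cnorm_ge0.
exists (\sum_(k < N) cnorm (u k) + (1 + cnorm x)) => [|n].
  by rewrite !addr_ge0 ?cnorm_ge0.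
have [nN|Nn] := ltnP n N.
  rewrite (bigD1 (Ordinal nN)) //= -addrA lerDl addr_ge0 ?addr_ge0 ?cnorm_ge0 //.
  by apply: sumr_ge0 => k _; exact: cnorm_ge0.
apply: le_trans (_ : 1 + cnorm x <= _); last by rewrite lerDr.
have := hN n Nn; rewrite /= => h.
have -> : u n = (u n - x) + x by rewrite subrK.
by apply: le_trans (cnormD _ _) _; rewrite lerD2r ltW.
Qed.

Lemma series_term_bounded (u : nat -> C) (x : C) : series u @ \oo --> x ->
  exists2 M : R, 0 <= M & forall n, cnorm (u n) <= M.
Proof.
move=> /cvg_cnorm_bounded [M M0 hM]; exists (M + M) => [|n]; first exact: addr_ge0.
have -> : u n = series u n.+1 - series u n by rewrite seriesSr addrC addKr.
by apply: le_trans (cnormB _ _) _; rewrite lerD.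
Qed.

(** Boundedness at the larger radius rho gives decay like (r/rho)^k at radius r. *)
Lemma mid_ratio r : 0 <= r < 1 ->
  exists rho : R, [/\ 0 < rho < 1, 0 <= r / rho < 1 & r = rho * (r / rho)].
Proof.
move=> /andP[r0 r1]; exists ((1 + r) / 2).
have h0 : 0 < (1 + r) / 2 by lra.
split; [lra| |by rewrite mulrCA divff ?mulr1 // gt_eqF].
by rewrite divr_ge0 ?(ltW h0) //= ltr_pdivrMr // mul1r; lra.
Qed.

Lemma pseries_geo f b q : has_pseries f b -> cnorm q < 1 ->
  exists M s : R, [/\ 0 <= M, 0 <= s < 1 & forall k, cnorm (b k * q ^+ k) <= M * s ^+ k].
Proof.
move=> fb q1; have [|rho [rho01 s01 e]] := @mid_ratio (cnorm q).
  by rewrite cnorm_ge0.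
have /andP[rho0 rho1] := rho01.
have h : cnorm (rho%:C%C : C) < 1 by rewrite cnormr ger0_norm // ltW.
have [M M0 hM] := series_term_bounded (fb _ h).
exists M, (cnorm q / rho); split=> // k.
have := hM k; rewrite !cnormM !cnormX cnormr ger0_norm ?(ltW rho0) // => hk.
rewrite {1}e exprMn mulrA ler_wpM2r // exprn_ge0 //.
by case/andP: s01.
Qed.

(** A partial sum of the product is the sum of u_i times a partial sum of v of length n - i; the
    decay of u_i dominates. *)
Lemma has_pseries_mul f g b c : has_pseries f b -> has_pseries g c ->
  has_pseries (fun q => f q * g q) (cauchy_prod b c).
Proof.
move=> fb gc q q1; have [M [s [M0 s01 hM]]] := pseries_geo fb q1.
have [N N0 hN] := cvg_cnorm_bounded (gc _ q1).
pose u i : C := b i * q ^+ i; pose v i : C := c i * q ^+ i.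
pose w n i : C := if (i < n)%N then u i * series v (n - i)%N else 0.
have -> : series (fun k => cauchy_prod b c k * q ^+ k) = (fun n => \sum_(i < n) w n i).
  apply/funext => n; rewrite /series /= big_mkord.
  rewrite (eq_bigr (fun k : 'I_n => cauchy_prod u v k)); last first.
    by move=> k _; rewrite cauchy_prod_scale.
  rewrite sum_cauchy_prod; apply: eq_bigr => i _.
  by rewrite /w ltn_ord /series /= big_mkord.
have /andP[s0 s1] := s01.
apply: (@tannery _ w (fun i => u i * g q) _ _ (M * N) s) => //.
- exact: mulr_ge0.
- move=> n k; rewrite /w; case: ifP => _; last by rewrite cnorm0 !mulr_ge0 // exprn_ge0.
  rewrite cnormM mulrAC.
  exact: (ler_pM (cnorm_ge0 _) (cnorm_ge0 _) (hM k) (hN _)).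
- move=> k; apply: (@cvg_trans _ ((fun n => u k * series v (n - k)%N) @ \oo)).
    by apply: near_eq_cvg; exists k.+1 => // n /= kn; rewrite /w kn.
  apply: cvgM; first exact: cvg_cst.
  by apply: (cvg_comp_natD (d := k) _ (gc q q1)) => n; lia.
- by move=> n; apply: series_fin_cvg => k; rewrite /w ltnNge => ->.
- have -> : series (fun i => u i * g q) = (fun n => series u n * g q).
    by apply/funext => n; rewrite /series /= big_distrl.
  exact: cvgM (fb q q1) (cvg_cst _).
Qed.

(** A weighted l1 bound. It is submultiplicative under the Cauchy product, hence controls products
    of any number of factors. *)
Definition l1_le r b (M : R) : Prop :=
  forall n, \sum_(k < n) cnorm (b k) * r ^+ k <= M.

Lemma l1_le_mul r b c (M N : R) : 0 <= r -> 0 <= N ->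
  l1_le r b M -> l1_le r c N -> l1_le r (cauchy_prod b c) (M * N).
Proof.
move=> r0 N0 hb hc n.
apply: le_trans (_ : \sum_(k < n) cauchy_prod (fun i => cnorm (b i) * r ^+ i)
    (fun i => cnorm (c i) * r ^+ i) k <= _).
  apply: ler_sum => k _; rewrite -cauchy_prod_scale ler_wpM2r ?exprn_ge0 //.
  by apply: le_trans (cnorm_sum _ _ _) _; apply: ler_sum => i _; rewrite cnormM.
rewrite sum_cauchy_prod.
apply: le_trans (_ : \sum_(i < n) cnorm (b i) * r ^+ i * N <= _).
  apply: ler_sum => i _; apply: ler_wpM2l; last exact: hc.
  by rewrite mulr_ge0 ?cnorm_ge0 ?exprn_ge0.
by rewrite -big_distrl /=; apply: ler_wpM2r => //; exact: hb.
Qed.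

Lemma l1_le_coef r b M k : 0 <= r -> l1_le r b M -> cnorm (b k) * r ^+ k <= M.
Proof.
move=> r0 /(_ k.+1); apply: le_trans; rewrite big_ord_recr /= lerDr.
by apply: sumr_ge0 => i _; rewrite mulr_ge0 ?cnorm_ge0 ?exprn_ge0.
Qed.

Fixpoint prod_coef (d : nat -> nat -> C) n : nat -> C :=
  if n is n'.+1 then cauchy_prod (prod_coef d n') (d n') else fun k => (k == 0)%N%:R.

(** Factor j is 1 + O(q^(j+1)), so the coefficient of q^k is final after k factors and the diagonal
    of the partial products gives the expansion. *)
Lemma pseries_infinite_prod (u : nat -> C -> C) (d : nat -> nat -> C) f :
  (forall j, has_pseries (u j) (d j)) -> (forall j, d j 0%N = 1) ->
  (forall j i, (0 < i <= j)%N -> d j i = 0) ->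
  (forall j r, 0 <= r < 1 -> l1_le r (d j) (1 - r ^+ j.+1)^-1) ->
  (forall q, cnorm q < 1 -> (fun n => \prod_(j < n) u j q) @ \oo --> f q) ->
  exists b, has_pseries f b.
Proof.
move=> ud d0 dz dl uf; pose c := prod_coef d; exists (fun k => c k k).
have cE n : has_pseries (fun q => \prod_(j < n) u j q) (c n).
  elim: n => [|n IH] q q1.
    rewrite big_ord0 /=.
    have := @series_fin_cvg _ (fun k => (k == 0)%N%:R * q ^+ k : C) 1%N.
    rewrite big_ord1 expr0 mulr1; apply.
    by case=> // k _; rewrite mul0r.
  rewrite big_ord_recr /=; exact: (has_pseries_mul IH (ud n)).
have cS n k : (k <= n)%N -> c n.+1 k = c n k.
  move=> kn; rewrite /c /= /cauchy_prod big_ord_recr /= subnn d0 mulr1 big1 ?add0r //.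
  by move=> i _; rewrite dz ?mulr0 // subn_gt0 ltn_ord /= (leq_trans (leq_subr _ _) kn).
have cs n k : (k <= n)%N -> c n k = c k k.
  move=> /subnKC <-; elim: (n - k)%N => [|m IH]; first by rewrite addn0.
  by rewrite addnS cS ?leq_addr.
(* The partial products have l1 bound 1/(r; r)_n, which [qpoch_ge] bounds independently of n. *)
have cl r : 0 <= r < 1 -> exists2 B : R, 0 <= B & forall n, l1_le r (c n) B.
  move=> r01; have /andP[r0 r1] := r01.
  have [m m0 hm] := qpoch_ge r01 r01.
  pose N n : R := \prod_(j < n) (1 - r ^+ j.+1)^-1.
  have fac j : 0 < 1 - r ^+ j.+1 by rewrite subr_gt0 exprn_ilt1.
  have N0 n : 0 <= N n by apply: prodr_ge0 => j _; rewrite invr_ge0 ltW.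
  have hN n : l1_le r (c n) (N n).
    elim: n => [|n IH].
      rewrite /N big_ord0; case=> [|n]; first by rewrite big_ord0.
      rewrite big_ord_recl /= cnorm1 mulr1 big1 ?addr0 // => i _.
      by rewrite cnorm0 mul0r.
    rewrite /N big_ord_recr /=; apply: l1_le_mul => //; last exact: dl.
    by rewrite invr_ge0 ltW.
  exists m^-1; first by rewrite invr_ge0 ltW.
  move=> n k; apply: le_trans (hN n k) _; rewrite /N prodfV lef_pV2 ?posrE //; last first.
    by apply: prodr_gt0.
  have rr : cnorm (r%:C%C : C) <= r by rewrite cnormr ger0_norm.
  apply: le_trans (hm _ _ n rr rr) _; rewrite /qpoch cnorm_prod; apply: ler_prod => j _.
  have -> : 1 - r%:C%C * r%:C%C ^+ j = (1 - r ^+ j.+1)%:C%C :> C.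
    by rewrite rmorphB rmorph1 exprS rmorphM rmorphXn.
  by rewrite cnorm_ge0 /= cnormr ger0_norm // ltW.
move=> q q1; have [|rho [rho01 s01 e]] := @mid_ratio (cnorm q).
  by rewrite cnorm_ge0.
have /andP[rho0 rho1] := rho01; have /andP[s0 s1] := s01.
have [|B B0 hB] := cl rho; first by rewrite (ltW rho0).
have hc n k : cnorm (c n k * q ^+ k) <= B * (cnorm q / rho) ^+ k.
  rewrite cnormM cnormX {1}e exprMn mulrA ler_wpM2r ?exprn_ge0 //.
  exact: (l1_le_coef _ (ltW rho0) (hB n)).
have [x hx] := geo_series_cvg s01 (fun k => hc k k).
suff <- : x = f q by [].
apply: cvg_uniq (uf q q1).
apply: (tannery s01 B0 hc _ (fun n => cE n q q1) hx) => k.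
apply: (@cvg_trans _ ((fun=> c k k * q ^+ k) @ \oo)); last exact: cvg_cst.
by apply: near_eq_cvg; exists k => // n /= kn; rewrite cs.
Qed.

End PowerSeries.

(** * Expansion of infinite q-products and their reciprocals; the identity theorem *)

Section EulerProducts.
Variable R : realType.
Local Notation C := (R[i] : numFieldType).
Implicit Types (f g : C -> C) (b c d : nat -> C) (q : C) (r : R).

Lemma sum_dvdn (K : comPzRingType) (x : K) e n : (0 < e)%N ->
  \sum_(k < e + n) (e %| k)%N%:R * x ^+ k =
  1 + x ^+ e * \sum_(k < n) (e %| k)%N%:R * x ^+ k.
Proof.
move=> e0; rewrite big_split_ord /=; congr (_ + _).
  case: e e0 => // e _; rewrite big_ord_recl expr0 mulr1.
  rewrite (_ : (e.+1 %| ord0)%N) ?dvdn0 // big1 ?addr0 // => i _.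
  by rewrite gtnNdvd ?mul0r // lift0 ltnS.
rewrite big_distrr /=; apply: eq_bigr => k _.
by rewrite dvdn_addr // exprD mulrCA.
Qed.

Lemma sum_dvdn_le r e n : (0 < e)%N -> 0 <= r < 1 ->
  \sum_(k < n) (e %| k)%N%:R * r ^+ k <= (1 - r ^+ e)^-1.
Proof.
move=> e0 /andP[r0 r1]; have re : 0 < 1 - r ^+ e by rewrite subr_gt0 exprn_ilt1 // -lt0n.
rewrite -[leRHS]mul1r ler_pdivlMr // mulrBr mulr1 lerBlDr [_ * r ^+ e]mulrC -sum_dvdn //.
rewrite addnC big_split_ord /= lerDl; apply: sumr_ge0 => k _.
by rewrite mulr_ge0 ?ler0n ?exprn_ge0.
Qed.

(** Serves both 1 - q^e and 1/(1 - q^e), whose coefficients have modulus at most 1 and live on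
    multiples of e. *)
Lemma l1_le_dvdn r d e j : (j < e)%N -> 0 <= r < 1 ->
  (forall k, cnorm (d k) <= (e %| k)%N%:R) -> l1_le r d (1 - r ^+ j.+1)^-1.
Proof.
move=> je r01 hd n; have /andP[r0 r1] := r01.
apply: le_trans (_ : (1 - r ^+ e)^-1 <= _); last first.
  have h k : (0 < k)%N -> 0 < 1 - r ^+ k.
    by move=> k0; rewrite subr_gt0 exprn_ilt1 // -lt0n.
  by rewrite lef_pV2 ?posrE ?h ?(leq_ltn_trans _ je) // lerD2l lerN2 ler_wiXn2l // ltW.
apply: le_trans (sum_dvdn_le n (leq_ltn_trans (leq0n j) je) r01).
by apply: ler_sum => k _; rewrite ler_wpM2r ?exprn_ge0.
Qed.

Lemma has_pseries_1sub e : (0 < e)%N ->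
  has_pseries (fun q : C => 1 - q ^+ e) (fun k => (k == 0)%N%:R - (k == e)%N%:R).
Proof.
case: e => // e _ q q1.
have := @series_fin_cvg R (fun k => ((k == 0)%N%:R - (k == e.+1)%N%:R) * q ^+ k) e.+2.
rewrite big_ord_recl big_ord_recr /= /bump /= !add1n eqxx expr0 mulr1 subr0 sub0r mulN1r.
rewrite big1 => [|i _]; last by rewrite add1n eqSS (ltn_eqF (ltn_ord i)) subrr mul0r.
rewrite add0r; apply=> k ek.
by rewrite !gtn_eqF ?subrr ?mul0r // (leq_trans _ ek).
Qed.

Lemma has_pseries_1subV e : (0 < e)%N ->
  has_pseries (fun q : C => (1 - q ^+ e)^-1) (fun k => (e %| k)%N%:R).
Proof.
move=> e0 q q1; have q01 : 0 <= cnorm q < 1 by rewrite cnorm_ge0.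
have [k|s hs] := @geo_series_cvg R (fun k => (e %| k)%N%:R * q ^+ k) 1 (cnorm q) q01.
  rewrite cnormM cnormX ler_wpM2r ?exprn_ge0 ?cnorm_ge0 //.
  by case: (e %| k)%N; rewrite ?cnorm1 ?cnorm0.
(* Starting e terms later gives s = 1 + q^e s, which determines s. *)
have h1 : (fun n => series (fun k => (e %| k)%N%:R * q ^+ k) (e + n)%N) @ \oo --> s.
  by apply: (cvg_comp_nat _ hs) => n; rewrite leq_addl.
have h2 : (fun n => series (fun k => (e %| k)%N%:R * q ^+ k) (e + n)%N) @ \oo -->
    1 + q ^+ e * s.
  have -> : (fun n => series (fun k => (e %| k)%N%:R * q ^+ k) (e + n)%N) =
      (fun n => 1 + q ^+ e * series (fun k => (e %| k)%N%:R * q ^+ k) n).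
    by apply/funext => n; rewrite !seriesEord /= sum_dvdn.
  exact: cvgD (cvg_cst _) (cvgM (cvg_cst _) hs).
have n0 : 1 - q ^+ e != 0 by apply: one_sub_neq0; exact: cnormX_lt1.
suff -> : (1 - q ^+ e)^-1 = s by exact: hs.
apply: (mulfI n0); rewrite divff // mulrBl mul1r {1}(cvg_uniq h1 h2).
by rewrite addrK.
Qed.

Lemma pseries_qpoch_inf m k : (0 < m)%N -> (0 < k)%N ->
  exists b, has_pseries (fun q : C => qpoch_inf (q ^+ m) (q ^+ k)) b.
Proof.
move=> m0 k0.
have eP j : (j < m + k * j)%N by nia.
have e0 j : (0 < m + k * j)%N by exact: leq_ltn_trans (eP j).
apply: (@pseries_infinite_prod R (fun j q => 1 - q ^+ (m + k * j))
   (fun j i => (i == 0)%N%:R - (i == (m + k * j)%N)%:R)).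
- by move=> j; exact: has_pseries_1sub.
- by move=> j; rewrite eqxx ltn_eqF ?subr0.
- move=> j i /andP[i0 ij]; rewrite gtn_eqF // ltn_eqF ?subrr //.
  exact: leq_ltn_trans (eP j).
- move=> j r r01; apply: (l1_le_dvdn (eP j) r01) => i.
  case: eqP => [->|_]; first by rewrite ltn_eqF // subr0 cnorm1 dvdn0.
  case: eqP => [->|_]; first by rewrite sub0r cnormN cnorm1 dvdnn.
  by rewrite subrr cnorm0 ler0n.
- move=> q q1; have qk := cnormX_lt1 q1 k0.
  have -> : (fun n => \prod_(j < n) (1 - q ^+ (m + k * j))) = qpoch (q ^+ m) (q ^+ k).
    by apply/funext => n; apply: eq_bigr => j _; rewrite exprD exprM.
  exact: qpoch_cvg.
Qed.

Lemma pseries_qpoch_infV m k : (0 < m)%N -> (0 < k)%N ->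
  exists b, has_pseries (fun q : C => (qpoch_inf (q ^+ m) (q ^+ k))^-1) b.
Proof.
move=> m0 k0.
have eP j : (j < m + k * j)%N by nia.
have e0 j : (0 < m + k * j)%N by exact: leq_ltn_trans (eP j).
apply: (@pseries_infinite_prod R (fun j q => (1 - q ^+ (m + k * j))^-1)
   (fun j i => (m + k * j %| i)%N%:R)).
- by move=> j; exact: has_pseries_1subV.
- by move=> j; rewrite dvdn0.
- by move=> j i /andP[i0 ij]; rewrite gtnNdvd // (leq_ltn_trans ij (eP j)).
- move=> j r r01; apply: (l1_le_dvdn (eP j) r01) => i.
  by case: (_ %| i)%N; rewrite ?cnorm1 ?cnorm0.
- move=> q q1; have qk := cnormX_lt1 q1 k0; have qm := cnormX_lt1 q1 m0.
  have -> : (fun n => \prod_(j < n) (1 - q ^+ (m + k * j))^-1) =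
      (fun n => (qpoch (q ^+ m) (q ^+ k) n)^-1).
    apply/funext => n; rewrite prodfV; congr (_^-1).
    by apply: eq_bigr => j _; rewrite exprD exprM.
  apply: cvgV; [exact: qpoch_inf_neq0 | exact: qpoch_cvg].
Qed.

Lemma pseries_mul f g : (exists b, has_pseries f b) -> (exists b, has_pseries g b) ->
  exists b, has_pseries (fun q => f q * g q) b.
Proof. by move=> [b fb] [c gc]; exists (cauchy_prod b c); exact: has_pseries_mul. Qed.

(** Once the lower coefficients vanish, division by q^k leaves a null series with constant term d_k;
    evaluated near 0, its tail bounds d_k by any eps. *)
Lemma pseries_eq0 d :
  (forall q, 0 < cnorm q < 1 -> series (fun k => d k * q ^+ k) @ \oo --> (0 : C)) ->
  forall k, d k = 0.
Proof.
move=> h.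
have h2 : series (fun k => d k * (2^-1)%:C%C ^+ k) @ \oo --> (0 : C).
  by apply: h; rewrite cnormr ger0_norm; lra.
have [M M0 hM] := series_term_bounded h2.
have dM k : cnorm (d k) <= M * 2 ^+ k.
  have := hM k; rewrite cnormM cnormX cnormr ger0_norm ?invr_ge0 // => hk.
  by rewrite -ler_pdivrMr ?exprn_gt0 // -exprVn.
elim/ltn_ind => k IH; apply/eqP; rewrite -cnorm_eq0 eq_le cnorm_ge0 andbT.
apply/ler_addgt0Pr => eps eps0; rewrite add0r.
pose M' : R := M * 2 ^+ k.+1.
have M'0 : 0 <= M' by rewrite mulr_ge0 // exprn_ge0.
(* The tail bound is M' t/(1 - 2t). From t <= 1/4 it is at most 2 M' t, and the second bound makes
   this at most eps; the +1 keeps the divisor positive. *)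
pose t : R := Num.min (1 / 4) (eps / (2 * M' + 1)).
have D0 : 0 < 2 * M' + 1 by lra.
have t0 : 0 < t by rewrite lt_min; apply/andP; split; [lra | rewrite divr_gt0].
have t4 : t <= 1 / 4 by rewrite ge_min lexx.
have te : t * (2 * M' + 1) <= eps by rewrite -ler_pdivlMr // ge_min lexx orbT.
pose q : C := t%:C%C.
have qt : cnorm q = t by rewrite cnormr ger0_norm // ltW.
have qn0 : q != 0 by rewrite -cnorm_gt0 qt.
have hq : series (fun k => d k * q ^+ k) @ \oo --> (0 : C).
  by apply: h; rewrite qt t0 /=; lra.
pose v j : C := d (k + j)%N * q ^+ j.
have hv : series v @ \oo --> (0 : C).
  have -> : series v = (fun n => series (fun k => d k * q ^+ k) (k + n)%N / q ^+ k).
    apply/funext => n; rewrite !seriesEord /= big_split_ord /=.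
    rewrite [X in _ = (X + _) / _]big1 => [|i _]; last first.
      by rewrite IH // mul0r.
    rewrite add0r big_distrl /=; apply: eq_bigr => j _.
    by rewrite /v exprD mulrCA mulrAC mulfV ?mul1r // expf_neq0.
  rewrite -(mul0r (q ^+ k)^-1); apply: cvgM (cvg_cst _).
  by apply: (cvg_comp_nat _ hq) => n; rewrite leq_addl.
have vb j : cnorm (v j) <= M * 2 ^+ k * (2 * t) ^+ j.
  rewrite /v cnormM cnormX qt exprMn mulrA ler_wpM2r ?exprn_ge0 ?(ltW t0) //.
  by rewrite -mulrA -exprD.
have s01 : 0 <= 2 * t < 1 by lra.
have MK : 0 <= M * 2 ^+ k by rewrite mulr_ge0 // exprn_ge0.
have := geo_series_tail 1 s01 MK vb hv.
rewrite sub0r cnormN seriesEord /= big_ord1 /v addn0 expr0 mulr1 expr1 => hd.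
apply: le_trans hd _; apply: le_trans te.
rewrite ler_pdivrMr; last lra.
have -> : M * 2 ^+ k * (2 * t) = M' * t by rewrite /M' exprS; ring.
have : 0 <= M' * t by rewrite mulr_ge0 // ltW.
move=> mt0; nra.
Qed.

End EulerProducts.

(** * The huffed quotient *)

Lemma qpochs_inf2 (C : numFieldType) (A B q : C) :
  qpochs_inf [:: A; B] q = qpoch_inf A q * qpoch_inf B q.
Proof. by rewrite /qpochs_inf !big_cons big_nil mulr1. Qed.

Lemma qpochs_inf3 (C : numFieldType) (A B D q : C) :
  qpochs_inf [:: A; B; D] q = qpoch_inf A q * (qpoch_inf B q * qpoch_inf D q).
Proof. by rewrite /qpochs_inf !big_cons big_nil mulr1. Qed.

Section HuffedQuotient.
Variable R : realType.
Local Notation C := (R[i] : numFieldType).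

Definition chern_quotient (q : C) : C :=
  qpochs_inf [:: q ^+ 4; q ^+ 2; q^-1] (q ^+ 3) / qpoch_inf (q ^+ 9) (q ^+ 9)
  * series_sum (fun n : nat =>
      (-1) ^+ n * q ^+ (3 * 'C(n, 2) + 4 * n) * qpoch q (q ^+ 3) n
      / qpoch (q ^+ 9) (q ^+ 9) n).

Definition huffed_product (q : C) : C :=
  1 / (qpoch_inf (q ^+ 3) (q ^+ 3) * qpochs_inf [:: q ^+ 6; q ^+ 9] (q ^+ 18)).

(** The product E of the overview. *)
Definition cubic_factor (x : C) : C :=
  qpoch_inf (- x ^+ 3) (x ^+ 3) * qpoch_inf (x ^+ 4) (x ^+ 6)
  / (euler_phi x * euler_phi (x ^+ 2) * euler_phi (x ^+ 3)).

Section FixedNome.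
Variable q : C.
Hypotheses (q0 : q != 0) (q1 : cnorm q < 1).

Local Notation P m k := (qpoch_inf (q ^+ m) (q ^+ k)).

Let qk k : cnorm (q ^+ k.+1) < 1. Proof. exact: cnormX_lt1. Qed.
Let P0 m k : P m.+1 k.+1 != 0. Proof. by apply: qpoch_inf_neq0. Qed.

Let PS m k : P m k.+1 = (1 - q ^+ m) * P (m + k.+1) k.+1.
Proof. by rewrite (qpoch_infS _ (qk k)) -exprD. Qed.
Let P2 m k : P m k.+1 = P m (k.+1 * 2) * P (m + k.+1) (k.+1 * 2).
Proof. by rewrite (qpoch_inf_double _ (qk k)) -exprD -exprM. Qed.
Let P3 m k : P m k.+1 =
  P m (k.+1 * 3) * P (m + k.+1) (k.+1 * 3) * P (m + k.+1 * 2) (k.+1 * 3).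
Proof. by rewrite (qpoch_inf_triple _ (qk k)) -!exprM -!exprD. Qed.

Lemma exp_nome_inj : injective (fun n : nat => q ^+ n).
Proof.
move=> i j /= e; have := congr1 (@cnorm R) e; rewrite !cnormX.
by apply: ieexprIn; [rewrite cnorm_gt0 | rewrite lt_eqF].
Qed.

(** Since q - q^(6j+6) = q (1 - q^(6j+5)), the product yields q^n (q^5; q^6)_n, which cancels
    against (a^2 Q; Q^2)_n. *)
Lemma chern_term_cubic n : chern_term (q ^+ 3) q n =
  (-1) ^+ n * q ^+ (3 * 'C(n, 2) + 4 * n) * qpoch q (q ^+ 3) n / qpoch (q ^+ 9) (q ^+ 9) n.
Proof.
have e5 : q ^+ 2 * q ^+ 3 = q ^+ 5 by rewrite -exprD.
have e6 : (q ^+ 3) ^+ 2 = q ^+ 6 by rewrite -exprM.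
have e9 : (q ^+ 3) ^+ 3 = q ^+ 9 by rewrite -exprM.
have -> : chern_term (q ^+ 3) q n = (-1) ^+ n * (q ^+ 3) ^+ ('C(n, 2) + n) *
    qpoch q (q ^+ 3) n * \prod_(j < n) (q - (q ^+ 3) ^+ (2 * j.+1))
    / (qpoch (q ^+ 9) (q ^+ 9) n * qpoch (q ^+ 5) (q ^+ 6) n).
  by rewrite /chern_term e5 e6 e9.
have -> : \prod_(j < n) (q - (q ^+ 3) ^+ (2 * j.+1)) = q ^+ n * qpoch (q ^+ 5) (q ^+ 6) n.
  rewrite /qpoch -[in q ^+ n](card_ord n) -prodr_const -big_split /=.
  apply: eq_bigr => j _; rewrite mulrBr mulr1 -!exprM -exprD -exprS.
  by congr (_ - _ ^+ _); lia.
have n5 : qpoch (q ^+ 5) (q ^+ 6) n != 0 by apply: qpoch_neq0.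
have n9 : qpoch (q ^+ 9) (q ^+ 9) n != 0 by apply: qpoch_neq0.
have -> : q ^+ (3 * 'C(n, 2) + 4 * n) = (q ^+ 3) ^+ ('C(n, 2) + n) * q ^+ n.
  by rewrite -exprM -exprD; congr (_ ^+ _); lia.
move: (qpoch (q ^+ 5) _ n) (qpoch (q ^+ 9) _ n) n5 n9 => x y x0 y0.
by field; rewrite x0 y0.
Qed.

Lemma chern_sum_cubic : series_sum (fun n : nat =>
    (-1) ^+ n * q ^+ (3 * 'C(n, 2) + 4 * n) * qpoch q (q ^+ 3) n
    / qpoch (q ^+ 9) (q ^+ 9) n) =
  qpoch_inf (- q ^+ 9) (q ^+ 9) * (P 4 6 * P 12 18) / P 5 6.
Proof.
rewrite -(funext chern_term_cubic).
(* The exponents 6j + 1 and 6k never agree. *)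
have hq j k : q * (q ^+ 3) ^+ (2 * j) != (q ^+ 3) ^+ (2 * k).
  by rewrite -!exprM -exprS; apply/eqP => /exp_nome_inj; lia.
have := chern_sum (qk 2) q1 hq; rewrite -!exprM -!exprD -exprS /= => h.
by apply: (mulIf (P0 4 5)); rewrite divfK ?P0.
Qed.

(** Write (q^-1; q^3)_oo = -q^-1 (1 - q)(q^2; q^3)_oo. The factor 1 - q completes f_1; the second
    (q^2; q^3)_oo loses (q^5; q^6)_oo to the sum, and the remaining (q^2; q^6)_oo meets (q^4;
    q^6)_oo to form f_2 up to (q^6; q^6)_oo. *)
Lemma chern_quotient_prod : chern_quotient q =
  - (q^-1 * (euler_phi q * euler_phi (q ^+ 2)) * cubic_factor (q ^+ 3)).
Proof.
rewrite /chern_quotient chern_sum_cubic /cubic_factor /euler_phi -!exprM /=.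
rewrite qpochs_inf3.
have -> : qpoch_inf q^-1 (q ^+ 3) = (1 - q^-1) * P 2 3.
  have eV : q^-1 * q ^+ 3 = q ^+ 2 by rewrite [q ^+ 3]exprS mulKf.
  by rewrite (qpoch_infS _ (qk 2)) eV.
have e1 : qpoch_inf q q = (1 - q) * P 4 3 * P 2 3 * P 3 3.
  by have := P3 1 0; rewrite (PS 1 2) !expr1.
rewrite e1 (P3 2 1) (P2 2 2) /=.
have n3 := P0 2 2; have n5 := P0 4 5; have n6 := P0 5 5; have n9 := P0 8 8.
rewrite /= in n3 n5 n6 n9 *.
move: (P 4 3) (P 2 6) (P 5 6) (P 9 9) (P 4 6) (P 12 18) (P 3 3) (P 6 6)
  (qpoch_inf (- q ^+ 9) (q ^+ 9)) n3 n5 n6 n9.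
move=> a b c d e f g h l n3 n5 n6 n9.
by field; rewrite q0 n3 n5 n6 n9.
Qed.

Lemma cubic_factor_huffed :
  euler_phi ((q ^+ 3) ^+ 3) * euler_phi ((q ^+ 3) ^+ 6) * cubic_factor (q ^+ 3) =
  huffed_product q.
Proof.
rewrite /cubic_factor /huffed_product /euler_phi qpochs_inf2.
rewrite -!exprM /=; have := qpoch_inf_odd_distinct (qk 8); rewrite -exprM /= => hN.
rewrite [P 6 6](P3 6 5) /=.
have n3 := P0 2 2; have n6 := P0 5 17; have n12 := P0 11 17; have n18 := P0 17 17.
have n9 := P0 8 8; have n918 := P0 8 17.
have -> : qpoch_inf (- q ^+ 9) (q ^+ 9) = (P 9 18)^-1.
  by apply: (mulIf n918); rewrite hN mulVf.
rewrite /= in n3 n6 n12 n18 n9 n918 *.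
move: (P 9 9) (P 18 18) (P 9 18) (P 12 18) (P 3 3) (P 6 18) n3 n6 n12 n18 n9 n918.
move=> a b c d e f n3 n6 n12 n18 n9 n918.
by field; rewrite n3 n6 n12 n18 n9 n918.
Qed.

End FixedNome.

End HuffedQuotient.

(** * Laurent series and the huffing operator *)

Section LaurentSeries.
Variable C : numFieldType.
Implicit Types (a : int -> C) (q s : C) (N d n : nat).

Definition laurent_term a q N k : C := a (k%:Z - N%:Z) * q ^ (k%:Z - N%:Z).

Lemma laurent_term_shift a q N d n : (forall m : int, m < - N%:Z -> a m = 0) ->
  series (laurent_term a q (N + d)) (d + n)%N = series (laurent_term a q N) n.
Proof.
move=> ha; rewrite !seriesEord /= big_split_ord /= big1 => [|i _]; last first.
  by rewrite /laurent_term ha ?mul0r //; have := ltn_ord i; lia.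
rewrite add0r; apply: eq_bigr => i _; rewrite /laurent_term.
by have -> : (d + i)%N%:Z - (N + d)%N%:Z = i%:Z - N%:Z by lia.
Qed.

Lemma cube_root_powz (w : C) (m : int) : 1 + w + w ^+ 2 = 0 ->
  1 + w ^ m + (w ^+ 2) ^ m = if (3 %| m)%Z then 3 else 0.
Proof.
move=> w0; have w3 : w ^+ 3 = 1.
  by apply/eqP; rewrite -subr_eq0; apply/eqP; rewrite -(mulr0 (w - 1)) -w0; ring.
have wn0 : w != 0 by apply: contra_eq_neq w3 => ->; rewrite expr0n eq_sym oner_eq0.
have -> : (w ^+ 2) ^ m = (w ^ m) ^+ 2 by rewrite exprnP exprzAC -exprnP.
have [t [r [er hr]]] : exists t : int, exists r : nat, m = t * 3%:Z + r%:Z /\ (r < 3)%N.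
  by exists (m %/ 3)%Z, `|(m %% 3)%Z|%N; split; lia.
have -> : w ^ m = w ^+ r.
  by rewrite er expfzDr // [t * _]mulrC -exprz_exp -!exprnP w3 exp1rz mul1r.
have -> : (3 %| m)%Z = (r == 0)%N by lia.
case: r hr {er} => [|[|[|//]]] _ /=.
- by rewrite expr0 expr1n; ring.
- by rewrite expr1.
- by rewrite -exprM -w0 (exprD w 3 1) w3 mul1r expr1; ring.
Qed.

End LaurentSeries.

Section Huffing.
Variable R : realType.
Local Notation C := (R[i] : numFieldType).
Implicit Types (a : int -> C) (q s : C).

(** Each value of q comes with its own cut N; this imposes a common one, so that series at different
    points can be added. *)
Lemma laurent_sum_cvg a q s N : (forall m : int, m < - N%:Z -> a m = 0) ->
  laurent_sum a q s -> series (laurent_term a q N) @ \oo --> s.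
Proof.
move=> ha [N' [ha' hs]].
have hM : series (laurent_term a q (N' + N)) @ \oo --> s.
  apply: (@cvg_trans _ ((fun n => series (laurent_term a q N') (n - N)%N) @ \oo)).
    apply: near_eq_cvg; exists N => // n /= Nn.
    by rewrite -(laurent_term_shift q N _ ha') subnKC.
  by apply: (cvg_comp_natD (d := N) _ hs) => n; lia.
have -> : series (laurent_term a q N) =
    (fun n => series (laurent_term a q (N' + N)) (N' + n)%N).
  by apply/funext => n; rewrite addnC laurent_term_shift.
by apply: (cvg_comp_nat _ hM) => n; rewrite leq_addl.
Qed.

Lemma huff_cvg (f : C -> C) a q w N : q != 0 -> 1 + w + w ^+ 2 = 0 ->
  (forall v : C, v \in [:: 1; w; w ^+ 2] ->
     series (laurent_term a (v * q) N) @ \oo --> f (v * q)) ->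
  series (laurent_term (huff a) q N) @ \oo -->
    (f (1 * q) + f (w * q) + f (w ^+ 2 * q)) / 3.
Proof.
move=> q0 w0 h; have -> : series (laurent_term (huff a) q N) = (fun n =>
    (series (laurent_term a (1 * q) N) n + series (laurent_term a (w * q) N) n
     + series (laurent_term a (w ^+ 2 * q) N) n) / 3).
  apply/funext => n; rewrite /series /= -!big_split /= big_distrl /=.
  apply: eq_bigr => k _; rewrite /laurent_term /huff !expfzMl exp1rz.
  set m := k%:Z - N%:Z.
  transitivity (a m * q ^ m * (1 + w ^ m + (w ^+ 2) ^ m) / 3); last first.
    by rewrite /= [(w ^+ 2) ^ m](expfzMl w w); ring.
  rewrite (cube_root_powz m w0); case: ifP => _; last by rewrite mulr0 !mul0r.
  by rewrite mulfK // pnatr_eq0.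
apply: cvgM (cvg_cst _); apply: cvgD; first apply: cvgD; apply: h.
- exact: mem_head.
- by rewrite !inE eqxx orbT.
- by rewrite !inE eqxx !orbT.
Qed.

Lemma cube_root_exists : exists w : C, 1 + w + w ^+ 2 = 0.
Proof.
exists ((- (1 / 2)) +i* (Num.sqrt 3 / 2))%C; apply/eqP; rewrite expr2 eq_complex /=.
have h3 : Num.sqrt 3 * Num.sqrt 3 = 3 :> R by rewrite -expr2 sqr_sqrtr // ler0n.
by apply/andP; split; apply/eqP; nra.
Qed.

(** This carries a Laurent sum from the punctured disc to q = 0: a has to coincide with b, and to
    vanish at negative indices. *)
Lemma laurent_sum_unique a f b :
  (forall q : C, 0 < cnorm q < 1 -> laurent_sum a q (f q)) -> has_pseries f b ->
  forall q : C, cnorm q < 1 -> laurent_sum a q (f q).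
Proof.
move=> ha fb.
(* One point is evaluated only to extract N, whose vanishing condition concerns [a] alone. *)
have half : 0 < cnorm ((2^-1)%:C%C : C) < 1 by rewrite cnormr ger0_norm; lra.
have [N [haN _]] := ha _ half.
(* The difference of the two coefficient sequences of q^N f(q). *)
pose d k : C := a (k%:Z - N%:Z) - (if (N <= k)%N then b (k - N)%N else 0).
have d0 k : d k = 0.
  apply: pseries_eq0 => q q01; have /andP[qp q1] := q01.
  have q0 : q != 0 by rewrite -cnorm_gt0.
  have h1 : (fun n => q ^+ N * series (laurent_term a q N) n) @ \oo --> q ^+ N * f q.
    exact: cvgM (cvg_cst _) (laurent_sum_cvg haN (ha q q01)).
  have h2 : (fun n => q ^+ N * series (fun k => b k * q ^+ k) (n - N)%N) @ \oo --> q ^+ N * f q.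
    apply: cvgM; first exact: cvg_cst.
    by apply: (cvg_comp_natD (d := N) _ (fb q q1)) => n; lia.
  rewrite -(subrr (q ^+ N * f q)).
  apply: (@cvg_trans _ ((fun n => q ^+ N * series (laurent_term a q N) n -
      q ^+ N * series (fun k => b k * q ^+ k) (n - N)%N) @ \oo)); last exact: cvgB h1 h2.
  apply: near_eq_cvg; exists N => // n /= Nn; rewrite !seriesEord /= !big_distrr /=.
  pose G k : C := (if (N <= k)%N then b (k - N)%N else 0) * q ^+ k.
  have -> : \sum_(k < n) d k * q ^+ k =
      \sum_(k < n) a (k%:Z - N%:Z) * q ^+ k - \sum_(k < N + (n - N)) G k.
    by rewrite subnKC // -sumrB; apply: eq_bigr => j _; rewrite /d /G mulrBl.
  congr (_ - _).
    apply: eq_bigr => j _; rewrite /laurent_term mulrCA.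
    by congr (_ * _); rewrite !exprnP -expfzDr // addrCA subrr addr0.
  rewrite big_split_ord /= [X in _ = X + _]big1 => [|j _]; last first.
    by rewrite /G leqNgt ltn_ord mul0r.
  rewrite add0r; apply: eq_bigr => j _.
  by rewrite /G leq_addr addKn exprD mulrCA.
have aE (n : nat) : a n%:Z = b n.
  have := d0 (N + n)%N; rewrite /d leq_addr addKn.
  have -> : (N + n)%N%:Z - N%:Z = n%:Z by lia.
  by move/eqP; rewrite subr_eq0 => /eqP.
have a0 (m : int) : m < 0 -> a m = 0.
  move=> m0; have [mN|Nm] := ltP m (- N%:Z); first exact: haN.
  have := d0 (absz (m + N%:Z)); rewrite /d.
  have -> : (absz (m + N%:Z))%:Z - N%:Z = m by lia.
  by rewrite ifF ?subr0 //; lia.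
move=> q q1; exists 0%N; split=> [m|]; first by rewrite oppr0; exact: a0.
apply: cvg_series_ext (fb q q1) => k.
by rewrite subr0 aE -exprnP.
Qed.

End Huffing.

(** * Averaging over the cube roots of unity, and expansions at 0 *)

Section Huffed.
Variable R : realType.
Local Notation C := (R[i] : numFieldType).

Lemma chern_quotient_huffed (a : int -> C) (q : C) :
  laurent_expansion (@chern_quotient R) a -> q != 0 -> cnorm q < 1 ->
  laurent_sum (huff a) q (huffed_product q).
Proof.
move=> ha q0 q1.
have hq (v : C) : v != 0 -> cnorm v < 1 -> laurent_sum a v (chern_quotient v).
  by move=> v0 v1; apply: ha; rewrite normr_gt0 v0 -cnorm_lt1.
have [w w0] := cube_root_exists R.
have w3 : w ^+ 3 = 1.
  by apply/eqP; rewrite -subr_eq0; apply/eqP; rewrite -(mulr0 (w - 1)) -w0; ring.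
have cw : cnorm w = 1.
  apply/eqP; rewrite -(@pexpr_eq1 _ _ 3) ?cnorm_ge0 // -cnormX w3 cnorm1; exact: eqxx.
have v3 (v : C) : v \in [:: 1; w; w ^+ 2] -> v ^+ 3 = 1 /\ cnorm v = 1.
  rewrite !inE => /or3P[] /eqP ->; first by rewrite expr1n cnorm1.
    by rewrite w3 cw.
  by rewrite -exprM mulnC exprM w3 expr1n cnormX cw expr1n.
have vq (v : C) : v \in [:: 1; w; w ^+ 2] -> v * q != 0 /\ cnorm (v * q) < 1.
  by move=> /v3[_ cv]; rewrite cnormM cv mul1r -cnorm_gt0 cnormM cv mul1r cnorm_gt0.
have [N [haN _]] := hq q q0 q1; exists N; split=> [m mN|].
  by rewrite /huff haN // if_same.
have := @huff_cvg R (@chern_quotient R) a q w N q0 w0.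
have -> : (chern_quotient (1 * q) + chern_quotient (w * q) + chern_quotient (w ^+ 2 * q)) / 3
   = huffed_product q.
  (* Because v^3 = 1, only the powers of v q outside q^3 depend on v; their averages vanish, leaving
     the middle summand. *)
  have cE (v : C) : v \in [:: 1; w; w ^+ 2] -> chern_quotient (v * q) =
      (- (v * q)^-1 * (theta_phi ((q ^+ 3) ^+ 3) * theta_a (q ^+ 3))
       + euler_phi ((q ^+ 3) ^+ 3) * euler_phi ((q ^+ 3) ^+ 6)
       + 2 * (v * q) * (theta_b (q ^+ 3) * theta_psi ((q ^+ 3) ^+ 3)))
      * cubic_factor (q ^+ 3).
    move=> hv; have [vq0 vq1] := vq v hv; have [vv _] := v3 v hv.
    have e3 : (v * q) ^+ 3 = q ^+ 3 by rewrite exprMn vv mul1r.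
    rewrite chern_quotient_prod // euler_phi_dissect // e3.
    move: (v * q) (theta_phi _ * _) (euler_phi _ * _) (theta_b _ * _) (cubic_factor _) vq0.
    by move=> x A B D E x0; field.
  rewrite -(cubic_factor_huffed q1) !cE ?inE ?eqxx ?orbT //.
  have wn0 : w != 0 by rewrite -cnorm_gt0 cw.
  have -> : (1 * q)^-1 = q^-1 by rewrite mul1r.
  have -> : (w * q)^-1 = w ^+ 2 * q^-1.
    by rewrite invfM; congr (_ * _); apply: (mulfI wn0); rewrite divff // -exprS w3.
  have -> : (w ^+ 2 * q)^-1 = w * q^-1.
    rewrite invfM; congr (_ * _); apply: (mulfI (expf_neq0 2 wn0)).
    by rewrite divff ?expf_neq0 // -exprSr w3.
  move: (theta_phi _ * _) (euler_phi _ * _) (theta_b _ * _) (cubic_factor _) => A B D E.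
  have e1 : w ^+ 2 = - (1 + w) by apply/eqP; rewrite -addr_eq0 addrC w0.
  by rewrite e1; field.
apply=> v hv; have [vq0 vq1] := vq v hv.
exact: laurent_sum_cvg haN (hq _ vq0 vq1).
Qed.

Lemma pseries_ext (f g : C -> C) :
  (forall q, cnorm q < 1 -> f q = g q) ->
  (exists b, has_pseries f b) -> exists b, has_pseries g b.
Proof. by move=> fg [b fb]; exists b => q q1; rewrite -fg //; exact: fb. Qed.

Lemma pseries_huffed : exists b, has_pseries (@huffed_product R) b.
Proof.
have h m k := @pseries_qpoch_infV R m.+1 k.+1 isT isT.
apply: (pseries_ext _ (pseries_mul (h 2 2) (pseries_mul (h 5 17) (h 8 17)))) => q q1.
by rewrite /huffed_product qpochs_inf2 div1r !invfM.
Qed.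

Lemma pseries_quotient : exists b : nat -> C,
  has_pseries (fun q => euler_phi q * euler_phi (q ^+ 2) * cubic_factor (q ^+ 3)) b.
Proof.
have h m k := @pseries_qpoch_inf R m.+1 k.+1 isT isT.
have hV m k := @pseries_qpoch_infV R m.+1 k.+1 isT isT.
apply: (pseries_ext _ (pseries_mul (pseries_mul (h 0 0) (h 1 1))
  (pseries_mul (pseries_mul (hV 8 17) (h 11 17))
     (pseries_mul (pseries_mul (hV 2 2) (hV 5 5)) (hV 8 8))))) => q q1.
have q9 := cnormX_lt1 q1 (isT : 0 < 9)%N; have q18 := cnormX_lt1 q1 (isT : 0 < 18)%N.
rewrite /euler_phi /cubic_factor -!exprM /= !expr1 !invfM.
have := qpoch_inf_odd_distinct q9; rewrite -exprM /= => e.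
(* Its base is not a power of q, so the expansion lemmas apply only after Euler's identity rewrites
   it as a reciprocal. *)
have -> : qpoch_inf (- q ^+ 9) (q ^+ 9) = (qpoch_inf (q ^+ 9) (q ^+ 18))^-1.
  apply: (mulIf (qpoch_inf_neq0 q9 q18)); rewrite e mulVf //; exact: qpoch_inf_neq0.
by [].
Qed.

Lemma chern_quotient_laurent : exists a : int -> C, laurent_expansion (@chern_quotient R) a.
Proof.
have [b hb] := pseries_quotient.
(* Multiplication by -q^-1 shifts the power series by one place; [Negz 0] is the exponent -1. *)
exists (fun n => match n with Posz m => - b m.+1 | Negz 0 => - b 0%N | _ => 0 end).
move=> q /andP[q0 q1]; rewrite normr_gt0 in q0; rewrite -cnorm_lt1 in q1.
exists 1%N; split=> [[m|[|m]]|] //; rewrite chern_quotient_prod //.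
have := cvg_series_lin (a := - q^-1) (b := 0) (hb q q1) (hb q q1).
rewrite mul0r addr0 mulNr mulrA; apply: cvg_series_ext => k.
rewrite mul0r addr0; case: k => [|k] /=.
  by rewrite sub0r expr0 mulr1 mulrC mulrN -mulNr.
have -> : k.+1%:Z - 1%:Z = k%:Z by lia.
by rewrite -exprnP [q ^+ k.+1]exprS !mulNr mulrCA mulKf // subn1.
Qed.

End Huffed.

Theorem theorem3p3 (R : realType) :
  let F := fun q : R[i] =>
    qpochs_inf [:: q ^+ 4; q ^+ 2; q^-1] (q ^+ 3) / qpoch_inf (q ^+ 9) (q ^+ 9)
    * series_sum (fun n : nat =>
        (-1) ^+ n * q ^+ (3 * 'C(n, 2) + 4 * n) * qpoch q (q ^+ 3) n
        / qpoch (q ^+ 9) (q ^+ 9) n) in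
  (exists a : int -> R[i], laurent_expansion F a) /\
  (forall a : int -> R[i], laurent_expansion F a ->
   forall q : R[i], `|q| < 1 ->
     laurent_sum (huff a) q
       (1 / (qpoch_inf (q ^+ 3) (q ^+ 3)
             * qpochs_inf [:: q ^+ 6; q ^+ 9] (q ^+ 18)))).
Proof.
split; first exact: chern_quotient_laurent.
(* The right-hand side has a power series on the whole disc, so the case q != 0 settles q = 0 as
   well. *)
move=> a ha q q1; have [b hb] := pseries_huffed R.
apply: (laurent_sum_unique _ hb); last by rewrite cnorm_lt1.
move=> v /andP[v0 v1]; apply: chern_quotient_huffed => //.
by rewrite -cnorm_gt0.
Qed.
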